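(* Let $n$ be a positive integer and $0\le j\le \lfloor 3n/2\rfloor$. For a semistandard tableau $T$ of shape $(3n-j,j)$ and content $(n,n,n)$, let $k_{2,2}(T)$ and $k_{3,2}(T)$ be the numbers of entries $2$ and $3$ in its second row, and define $\mathrm{type}(T)\in\mathrm{SYT}_3$ by: - $\mathrm{type}(T)=t_{123}$ if $k_{2,2}$ is even and either $k_{2,2}<\lfloor k_{3,2}/2\rfloor$, or ($k_{2,2}=\lfloor k_{3,2}/2\rfloor$ and $j\equiv 0 \pmod 3$); - $\mathrm{type}(T)=t_{12|3}$ if $k_{2,2}$ is even and either $k_{2,2}>\lfloor k_{3,2}/2\rfloor$, or ($k_{2,2}=\lfloor k_{3,2}/2\rfloor$ and $j\equiv 1 \pmod 3$); - $\mathrm{type}(T)=t_{1|2|3}$ if $k_{2,2}$ is odd and either $k_{2,2}<\lfloor k_{3,2}/2\rfloor$, or ($k_{2,2}=\lfloor k_{3,2}/2\rfloor$ and $j\equiv 0 \pmod 3$); - $\mathrm{type}(T)=t_{13|2}$ if $k_{2,2}$ is odd and either $k_{2,2}>\lfloor k_{3,2}/2\rfloor$, or ($k_{2,2}=\lfloor k_{3,2}/2\rfloor$ and $j\equiv 1 \pmod 3$). Then for every standard tableau $t\in\mathrm{SYT}_3$, $$\#\{T\in \mathrm{SSYT}((3n-j,j),(n,n,n)) : \mathrm{type}(T)=t\} = \langle s_{(3n-j,j)},\, s_{\mathrm{shape}(t)}[h_n]\rangle .$$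
   Context: Semistandard tableaux have weakly increasing rows and strictly increasing columns; $\mathrm{SSYT}(\mu,\beta)$ is the set of semistandard tableaux of shape $\mu$ and content $\beta$ (content $(n,n,n)$ means each of $1,2,3$ appears $n$ times). $\mathrm{SYT}_3$ is the set of the four standard Young tableaux with 3 cells: $t_{123}$ (one row $1,2,3$), $t_{12|3}$ (rows $\{1,2\}$ and $\{3\}$), $t_{13|2}$ (rows $\{1,3\}$ and $\{2\}$), $t_{1|2|3}$ (one column). $s_\lambda$ denotes a Schur function, $h_n=s_{(n)}$, $f[g]$ denotes plethysm of symmetric functions, and $\langle\cdot,\cdot\rangle$ is the Hall inner product for which Schur functions are orthonormal. *)

(* Defs.v *)
From HB Require Import structures.
From Stdlib Require Import ClassicalEpsilon.
From mathcomp Require Import all_boot all_order all_algebra.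
From mathcomp Require Import finmap mpoly.

Set Implicit Arguments.
Unset Strict Implicit.
Unset Printing Implicit Defensive.

Import GRing.Theory.
Local Open Scope ring_scope.

(* Shapes are sequences of row lengths (trailing zeros are harmless); rows and
   columns of a diagram, and the letters of a filling, are numbered from 0.
   Thus the letters 1, 2, 3 are the elements 0, 1, 2 of 'I_3. *)
Definition cell (l : seq nat) : finType :=
  {i : 'I_(size l) & 'I_(nth 0%N l i)}.

Definition row_of (l : seq nat) (c : cell l) : nat := tag c.
Definition col_of (l : seq nat) (c : cell l) : nat := tagged c.

Definition filling (l : seq nat) (N : nat) : finType := {ffun cell l -> 'I_N}.

Definition rows_weakly_increasing l N (T : filling l N) : bool :=
  [forall c : cell l, forall d : cell l,
     (row_of c == row_of d) && (col_of c <= col_of d)%N ==> (T c <= T d)%N].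

Definition cols_strictly_increasing l N (T : filling l N) : bool :=
  [forall c : cell l, forall d : cell l,
     (col_of c == col_of d) && (row_of c < row_of d)%N ==> (T c < T d)%N].

Definition semistandard l N (T : filling l N) : bool :=
  rows_weakly_increasing T && cols_strictly_increasing T.

Definition content l N (T : filling l N) (a : 'I_N) : nat :=
  #|[set c : cell l | T c == a]|.

Definition SSYT (l : seq nat) N (beta : 'I_N -> nat) : {set filling l N} :=
  [set T : filling l N | semistandard T & [forall a, content T a == beta a]].

(* A symmetric function f with rational coefficients is represented by the
   family of its restrictions f(x_0, ..., x_(N-1), 0, 0, ...), N in nat. *)
Definition symfun : Type := forall N : nat, {mpoly rat[N]}.

Definition schur (l : seq nat) : symfun := fun N =>
  \sum_(T : filling l N | semistandard T) \prod_(c : cell l) 'X_(T c).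

Definition hsym (n : nat) : symfun := schur [:: n].

Definition psum (k : nat) : symfun := fun N => \sum_(i < N) 'X_i ^+ k.

(* f = P(p_1, ..., p_m), where the pair (m, P) is packed as a dependent sum *)
Definition psum_expression (f : symfun) (P : {m : nat & {mpoly rat[m]}}) : Prop :=
  forall N, f N = tagged P \mPo [tuple psum i.+1 N | i < tag P].

(* p_k[g] = g(x_0^k, x_1^k, ...) *)
Definition psum_plethysm (k : nat) (g : symfun) : symfun := fun N =>
  g N \mPo [tuple 'X_i ^+ k | i < N].

(* f |-> f[g] is the algebra morphism with p_k |-> p_k[g]. Since the power sums
   are algebraically independent generators of the ring of symmetric functions
   over rat, the expression selected by epsilon is the unique one, up to the
   number m of power sums it is allowed to mention. *)
Definition plethysm (f g : symfun) : symfun :=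
  let P := epsilon (inhabits (Tagged (fun m => {mpoly rat[m]}) (0 : {mpoly rat[0]})))
                   (psum_expression f) in
  fun N => tagged P \mPo [tuple psum_plethysm i.+1 g N | i < tag P].

Definition is_intpart (l : seq nat) : bool :=
  sorted geq l && (0%N \notin l).

Definition intpart : choiceType := {l : seq nat | is_intpart l}.

Definition schur_expansion (f : symfun) (a : {fsfun intpart -> rat with 0}) : Prop :=
  forall N, f N = \sum_(l <- finsupp a) a l *: schur (val l) N.

(* The coordinates of f in the basis of Schur functions. *)
Definition schur_coord (f : symfun) : {fsfun intpart -> rat with 0} :=
  epsilon (inhabits [fsfun]) (schur_expansion f).

(* The bilinear form for which the Schur functions are orthonormal. *)
Definition hall (f g : symfun) : rat :=
  \sum_(l <- finsupp (schur_coord f)) schur_coord f l * schur_coord g l.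

(* A standard tableau is given by the list of its rows, so that its shape is
   seq.shape. *)
Definition t123   : seq (seq nat) := [:: [:: 1; 2; 3]]%N.
Definition t12_3  : seq (seq nat) := [:: [:: 1; 2]; [:: 3]]%N.
Definition t13_2  : seq (seq nat) := [:: [:: 1; 3]; [:: 2]]%N.
Definition t1_2_3 : seq (seq nat) := [:: [:: 1]; [:: 2]; [:: 3]]%N.

Definition SYT3 : seq (seq (seq nat)) := [:: t123; t12_3; t13_2; t1_2_3].

Definition two_row (n j : nat) : seq nat := [:: 3 * n - j; j]%N.

(* The number of letters a.+1 in the second row. *)
Definition second_row_count l N (T : filling l N) (a : nat) : nat :=
  #|[set c : cell l | (row_of c == 1%N) && (val (T c) == a)]|.

Definition k22 l (T : filling l 3) : nat := second_row_count T 1.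
Definition k32 l (T : filling l 3) : nat := second_row_count T 2.

(* On semistandard T the second row contains no letter 1, so j = k22 + k32, the
   case k22 = k32./2 forces j = 0 or 1 modulo 3, and None never occurs. *)
Definition tab_type (n j : nat) (T : filling (two_row n j) 3)
    : option (seq (seq nat)) :=
  let low  := (k22 T < (k32 T)./2)%N || ((k22 T == (k32 T)./2) && (j %% 3 == 0)%N) in
  let high := (k22 T > (k32 T)./2)%N || ((k22 T == (k32 T)./2) && (j %% 3 == 1)%N) in
  if ~~ odd (k22 T) && low then Some t123
  else if ~~ odd (k22 T) && high then Some t12_3
  else if odd (k22 T) && low then Some t1_2_3
  else if odd (k22 T) && high then Some t13_2
  else None.

(* Main.v *)
From HB Require Import structures.
From Stdlib Require Import ClassicalEpsilon.
Require Import Defs.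
From mathcomp Require Import all_boot all_order all_algebra.
From mathcomp Require Import finmap mpoly.
From mathcomp Require Import zify ring lra.

Set Implicit Arguments.
Unset Strict Implicit.
Unset Printing Implicit Defensive.

Import Order.TTheory GRing.Theory Num.Theory.
Local Open Scope ring_scope.

(** Since h_n is a sum of monomials, s_mu[h_n] is s_mu evaluated at these
    monomials. For |mu| = 3 it is a combination of h_n^3, h_n p_2[h_n] and
    p_3[h_n], and the identities p_2[H](t^2) = H(t) H(-t) and
    p_3[H](t^3) = H(t) H(wt) H(w^2 t), with w a cube root of unity, turn all
    three into combinations of products h_a h_b h_c. By the Jacobi-Trudi
    formula for three rows (proved by removing the largest letter), such
    products are combinations of Schur functions with at most three rows.
    Schur functions are linearly independent, by dominance of contents, so the
    multiplicity of s_(3n-j,j) can be read off in the variables (1, q): it is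
    the coefficient of q^j in (1 - q) s_mu[h_n](1, q). On the other side, a
    tableau of shape (3n-j,j) and content (n,n,n) is determined by the number
    a of its entries 2 in the second row, which runs over an interval; the
    type only depends on the parity of a and on its position relative to about
    j/3, so both sides are explicit quasi-polynomials in n and j. *)

(** * Cells and values of Schur polynomials *)

Lemma ltn_nth_size (l : seq nat) i j : (j < nth 0 l i)%N -> (i < size l)%N.
Proof. by case: (ltnP i (size l)) => // /(nth_default 0%N) ->. Qed.

Definition mkcell l i j (lt_j : (j < nth 0 l i)%N) : cell l :=
  @Tagged 'I_(size l) (Ordinal (ltn_nth_size lt_j)) (fun i => 'I_(nth 0%N l i))
    (Ordinal lt_j).

Lemma row_mkcell l i j (lt_j : (j < nth 0 l i)%N) : row_of (mkcell lt_j) = i.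
Proof. by []. Qed.

Lemma col_mkcell l i j (lt_j : (j < nth 0 l i)%N) : col_of (mkcell lt_j) = j.
Proof. by []. Qed.

Lemma ltn_col l (c : cell l) : (col_of c < nth 0 l (row_of c))%N.
Proof. exact: ltn_ord. Qed.

Lemma ltn_row l (c : cell l) : (row_of c < size l)%N.
Proof. exact: ltn_ord. Qed.

Lemma cell_ext l (c d : cell l) :
  row_of c = row_of d -> col_of c = col_of d -> c = d.
Proof.
case: c d => [i a] [i' a']; rewrite /row_of /col_of /= => /val_inj eq_i.
by subst i' => /val_inj ->.
Qed.

Lemma big_cell (R : Type) (idx : R) (op : Monoid.com_law idx) l (F : nat -> nat -> R) :
  \big[op/idx]_(c : cell l) F (row_of c) (col_of c)
    = \big[op/idx]_(i < size l) \big[op/idx]_(j < nth 0%N l i) F i j.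
Proof.
by rewrite (sig_big_dep (fun _ => true) (fun _ _ => true)
              (fun (i : 'I_(size l)) (j : 'I_(nth 0%N l i)) => F i j)).
Qed.

Lemma card_cell l (P : nat -> nat -> bool) :
  #|[set c : cell l | P (row_of c) (col_of c)]|
    = (\sum_(i < size l) \sum_(j < nth 0 l i) P i j)%N.
Proof.
rewrite -(@big_cell nat 0%N addn l (fun i j => nat_of_bool (P i j))).
by rewrite -sum1_card -big_mkcond /=; apply: eq_bigl => c; rewrite inE.
Qed.

Lemma semistandardP l N (T : filling l N) :
  reflect ((forall c d : cell l, row_of c = row_of d -> (col_of c <= col_of d)%N ->
             (T c <= T d)%N) /\
           (forall c d : cell l, col_of c = col_of d -> (row_of c < row_of d)%N ->
             (T c < T d)%N))
          (semistandard T).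
Proof.
apply: (iffP andP) => -[rT cT]; split.
- move=> c d e le_cd.
  by move/forallP/(_ c)/forallP/(_ d)/implyP: rT; apply; rewrite e eqxx.
- move=> c d e lt_cd.
  by move/forallP/(_ c)/forallP/(_ d)/implyP: cT; apply; rewrite e eqxx.
- apply/forallP => c; apply/forallP => d; apply/implyP => /andP[/eqP e le_cd].
  exact: rT.
- apply/forallP => c; apply/forallP => d; apply/implyP => /andP[/eqP e lt_cd].
  exact: cT.
Qed.

(* Only x_0, ..., x_(N-1) matter. *)
Definition schurv (R : comNzRingType) (x : nat -> R) (l : seq nat) (N : nat) : R :=
  \sum_(T : filling l N | semistandard T) \prod_(c : cell l) x (T c).

Lemma eq_schurv (R : comNzRingType) (x y : nat -> R) l N :
  (forall i, (i < N)%N -> x i = y i) -> schurv x l N = schurv y l N.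
Proof.
by move=> eq_xy; apply: eq_bigr => T _; apply: eq_bigr => c _; apply: eq_xy.
Qed.

Lemma rmorph_schurv (R S : comNzRingType) (f : {rmorphism R -> S}) x l N :
  f (schurv x l N) = schurv (f \o x) l N.
Proof.
rewrite /schurv rmorph_sum; apply: eq_bigr => T _.
by rewrite rmorph_prod.
Qed.

(** Continued by 0 past [N], to be a family indexed by [nat] as [schurv] expects. *)
Definition mvar N (i : nat) : {mpoly rat[N]} :=
  if insub i is Some i' then 'X_i' else 0.

Lemma mvarE N (i : 'I_N) : mvar N i = 'X_i.
Proof. by rewrite /mvar valK. Qed.

Lemma schurE l N : schur l N = schurv (mvar N) l N.
Proof.
by apply: eq_bigr => T _; apply: eq_bigr => c _; rewrite mvarE.
Qed.

Lemma comp_schur (m N : nat) l (x : m.-tuple {mpoly rat[N]}) :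
  schur l m \mPo x = schurv (nth 0 x) l m.
Proof.
rewrite schurE rmorph_schurv; apply: eq_schurv => i lt_i /=.
by rewrite (mvarE (Ordinal lt_i)) comp_mpolyXU.
Qed.

(** The shapes can differ only by trailing zeros, but their cell types are distinct; fillings are
    transported along the bijection that keeps row and column. *)
Lemma schurv_shape (R : comNzRingType) (x : nat -> R) l l' N :
  (forall i, nth 0%N l i = nth 0%N l' i) -> schurv x l N = schurv x l' N.
Proof.
move=> eq_l.
have lt1 (c : cell l) : (col_of c < nth 0 l' (row_of c))%N by rewrite -eq_l ltn_col.
have lt2 (c : cell l') : (col_of c < nth 0 l (row_of c))%N by rewrite eq_l ltn_col.
pose f c := mkcell (lt1 c); pose g c := mkcell (lt2 c).
have fK : cancel f g by move=> c; apply: cell_ext.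
have gK : cancel g f by move=> c; apply: cell_ext.
pose F (T : filling l' N) : filling l N := [ffun c => T (f c)].
pose G (T : filling l N) : filling l' N := [ffun c => T (g c)].
have FK : cancel F G by move=> T; apply/ffunP => c; rewrite !ffunE gK.
have GK : cancel G F by move=> T; apply/ffunP => c; rewrite !ffunE fK.
rewrite /schurv (reindex F); last by exists G => T _; [apply: FK | apply: GK].
apply: eq_big => [T | T _].
  apply/semistandardP/semistandardP => -[rT cT]; split=> c d e h.
  - by have := rT (g c) (g d) e h; rewrite !ffunE !gK.
  - by have := cT (g c) (g d) e h; rewrite !ffunE !gK.
  - by rewrite !ffunE; apply: rT.
  - by rewrite !ffunE; apply: cT.
rewrite [RHS](reindex f); last by exists g => c _; [apply: fK | apply: gK].
by apply: eq_bigr => c _; rewrite ffunE.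
Qed.

(** * Removing the largest letter *)

Lemma card_row_prefix l i k :
  #|[set c : cell l | (row_of c == i) && (col_of c < k)%N]| = minn k (nth 0%N l i).
Proof.
rewrite (card_cell l (fun i' j => (i' == i) && (j < k)%N)).
have sum_lt (a : nat) : (\sum_(j < a) (j < k)%N)%N = minn k a.
  elim: a => [|a IH]; first by rewrite big_ord0 minn0.
  by rewrite big_ord_recr IH /=; lia.
case: (ltnP i (size l)) => [lt_i | ge_i].
  rewrite (bigD1 (Ordinal lt_i)) //= [X in (_ + X)%N]big1 ?addn0.
    rewrite -sum_lt; apply: eq_bigr => j _; by rewrite eqxx.
  move=> i' ne_i'; rewrite big1 // => j _.
  by rewrite -[(_ == i)]/(i' == Ordinal lt_i) (negPf ne_i').
rewrite nth_default // minn0 big1 // => i' _; rewrite big1 // => j _.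
have /ltn_eqF -> : (i' < i)%N by apply: leq_trans ge_i.
by [].
Qed.

Definition row_count_below l N (T : filling l N) (i v : nat) : nat :=
  #|[set c : cell l | (row_of c == i) && (T c < v)%N]|.

(** Rows increase weakly, so the letters below [v] fill an initial segment of each row and its
    length decides. Both directions compare this segment with a prefix of the row. *)
Lemma ltn_row_count l N (T : filling l N) v (c : cell l) : semistandard T ->
  (T c < v)%N = (col_of c < row_count_below T (row_of c) v)%N.
Proof.
move=> /semistandardP[rT _]; apply/idP/idP => [lt_v | ].
  have -> : (col_of c).+1 = #|[set d : cell l | (row_of d == row_of c)
                                  && (col_of d < (col_of c).+1)%N]|.
    by rewrite card_row_prefix; have := ltn_col c; lia.
  apply/subset_leq_card/subsetP => d; rewrite !inE => /andP[/eqP e le_d].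
  by rewrite e eqxx /=; apply: leq_ltn_trans lt_v; apply: rT.
apply: contraLR; rewrite -!leqNgt => ge_v.
rewrite -[leqRHS](minn_idPl (ltnW (ltn_col c))) -card_row_prefix.
apply/subset_leq_card/subsetP => d; rewrite !inE => /andP[/eqP e lt_v].
rewrite e eqxx /= ltnNge; apply: contraL lt_v => le_c.
by rewrite -leqNgt; apply: leq_trans ge_v _; apply: rT.
Qed.

Lemma row_count_le l N (T : filling l N) i v :
  (row_count_below T i v <= nth 0 l i)%N.
Proof.
rewrite -[leqRHS]minnn -card_row_prefix.
apply/subset_leq_card/subsetP => d; rewrite !inE => /andP[/eqP e _].
by rewrite e eqxx -e ltn_col.
Qed.

Lemma card_cells l : #|cell l| = sumn l.
Proof.
rewrite -sum1_card (big_cell _ l (fun _ _ => 1%N)) sumnE (big_nth 0%N) big_mkord.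
by apply: eq_bigr => i _; rewrite sum1_card card_ord.
Qed.

(** Matching on [@idP] supplies the proof of the bound that [mkcell] needs. *)
Definition find_cell l i j : option (cell l) :=
  if @idP (j < nth 0 l i)%N is ReflectT lt_j then Some (mkcell lt_j) else None.

Lemma find_cellT l (c : cell l) : find_cell l (row_of c) (col_of c) = Some c.
Proof.
rewrite /find_cell; case: {-}_ / idP => [lt_c | /(_ (ltn_col c)) //].
by congr Some; apply: cell_ext.
Qed.

Lemma find_cellF l i j : (nth 0 l i <= j)%N -> find_cell l i j = None.
Proof. by rewrite /find_cell; case: {-}_ / idP => // lt_j; rewrite leqNgt lt_j. Qed.

Section Branching.
Variables (R : comNzRingType) (x : nat -> R) (l m : seq nat) (N : nat).
Hypothesis sub_ml : forall i, (nth 0 m i <= nth 0 l i)%N.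
Hypothesis interlace : forall i, (nth 0 l i.+1 <= nth 0 m i)%N.

Let nth_lt i j : (i < j)%N -> (nth 0 l j <= nth 0 m i)%N.
Proof.
elim: j => // j IH; rewrite ltnS leq_eqVlt => /orP[/eqP-> // | /IH].
by apply: leq_trans; apply: leq_trans (sub_ml j).
Qed.

Definition embed_cell (d : cell m) : cell l :=
  mkcell (leq_trans (ltn_col d) (sub_ml (row_of d))).

(** Inverse of deleting the largest letter: the cells of [l] outside [m] all receive the letter
    [N]. *)
Definition extend_filling (S : filling m N) : filling l N.+1 :=
  [ffun c => if find_cell m (row_of c) (col_of c) is Some d
             then widen_ord (leqnSn N) (S d) else ord_max].

Lemma embed_cellP (c : cell l) :
  (col_of c < nth 0 m (row_of c))%N -> exists d, c = embed_cell d.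
Proof. by move=> lt_c; exists (mkcell lt_c); apply: cell_ext. Qed.

Lemma embed_cell_inj : injective embed_cell.
Proof.
move=> c d e; apply: cell_ext; first exact: (congr1 (@row_of l) e).
exact: (congr1 (@col_of l) e).
Qed.

Lemma extend_in S d : extend_filling S (embed_cell d) = S d :> nat.
Proof. by rewrite ffunE find_cellT. Qed.

Lemma extend_out S c : (nth 0 m (row_of c) <= col_of c)%N ->
  extend_filling S c = N :> nat.
Proof. by move=> le_c; rewrite ffunE find_cellF. Qed.

Lemma extend_lt S c : (extend_filling S c < N)%N = (col_of c < nth 0 m (row_of c))%N.
Proof.
case: (ltnP (col_of c)) => [/embed_cellP[d ->] | /extend_out ->]; last by rewrite ltnn.
by rewrite extend_in ltn_ord.
Qed.

Lemma extend_inj : injective extend_filling.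
Proof.
move=> S S' e; apply/ffunP => d; apply: val_inj.
by rewrite /= -!extend_in e.
Qed.

(** By interlacing, [l] has at most one cell outside [m] in each column, namely the lowest. A cell
    above another one in its column therefore lies in [m] and carries a letter below [N]. *)
Lemma extend_semistandard S : semistandard S -> semistandard (extend_filling S).
Proof.
move=> /semistandardP[rS cS]; apply/semistandardP; split=> c d.
  move=> e le_cd; case: (ltnP (col_of d) (nth 0%N m (row_of d))) => [lt_d | /extend_out ->].
    have [c' ec'] : exists c', c = embed_cell c'.
      by apply: embed_cellP; rewrite e; apply: leq_ltn_trans lt_d.
    have [d' ed'] := embed_cellP lt_d; subst c d; rewrite !extend_in.
    exact: rS.
  by rewrite -ltnS ltn_ord.
move=> e lt_cd.
have lt_c : (col_of c < nth 0 m (row_of c))%N.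
  by rewrite e; apply: leq_trans (ltn_col d) (nth_lt lt_cd).
case: (ltnP (col_of d) (nth 0%N m (row_of d))) => [lt_d | /extend_out ->].
  have [c' ec'] := embed_cellP lt_c; have [d' ed'] := embed_cellP lt_d.
  by subst c d; rewrite !extend_in; apply: cS.
by rewrite extend_lt.
Qed.

(** The row counts of the letters below [N] say that these letters occupy exactly the cells of [m];
    restricting to [m] then recovers [S]. *)
Lemma extend_image :
  [set extend_filling S | S in [set S | semistandard S]]
    = [set T : filling l N.+1 | semistandard T
         & [forall i : 'I_(size l), row_count_below T i N == nth 0 m i]%N].
Proof.
apply/setP => T; rewrite inE; apply/imsetP/idP => [[S] | /andP[sT /forallP cT]].
  rewrite inE => sS ->; rewrite extend_semistandard //=.
  apply/forallP => i; apply/eqP; rewrite -[RHS](minn_idPl (sub_ml i)) -card_row_prefix.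
  apply: eq_card => c; rewrite !inE extend_lt; case: eqP => // -> //.
have ltT c : (T c < N)%N = (col_of c < nth 0 m (row_of c))%N.
  by rewrite ltn_row_count // -(eqP (cT (tag c))).
have ltT' d : (T (embed_cell d) < N)%N by rewrite ltT; apply: ltn_col.
pose S : filling m N := [ffun d => Ordinal (ltT' d)].
have eT : T = extend_filling S.
  apply/ffunP => c; apply: val_inj => /=.
  have [/embed_cellP[d ->] | ge_c] := ltnP (col_of c) (nth 0%N m (row_of c)).
    by rewrite extend_in ffunE.
  rewrite extend_out //; apply/eqP; rewrite eqn_leq -ltnS ltn_ord /=.
  by rewrite leqNgt ltT -leqNgt.
exists S => //; rewrite inE; move/semistandardP: sT => [rT cT'].
by apply/semistandardP; split=> c d e h; rewrite !ffunE; [apply: rT | apply: cT'].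
Qed.

Lemma prod_extend S :
  \prod_(c : cell l) x (extend_filling S c)
    = x N ^+ (sumn l - sumn m) * \prod_(d : cell m) x (S d).
Proof.
pose I := [set embed_cell d | d in [set: cell m]].
have inI c : (c \in I) = (col_of c < nth 0 m (row_of c))%N.
  apply/imsetP/idP => [[d _ ->] | /embed_cellP[d ->]]; first exact: ltn_col.
  by exists d.
rewrite (bigID (mem I)) /= mulrC; congr (_ * _).
  rewrite (eq_bigr (fun _ => x N)) => [|c]; last first.
    by rewrite inI -leqNgt => /extend_out ->.
  rewrite prodr_const; congr (_ ^+ _).
  rewrite -!card_cells -(cardC (mem I)) /= -[#|cell m|]cardsT.
  rewrite (card_imset _ embed_cell_inj) addKn.
  by apply: eq_card => c; rewrite !inE.
rewrite big_imset /= => [|? ? _ _ /embed_cell_inj //].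
by rewrite big_set /=; apply: eq_bigr => d _; rewrite extend_in.
Qed.

Lemma schurv_branch_fixed :
  \sum_(T : filling l N.+1 | semistandard T
         && [forall i : 'I_(size l), row_count_below T i N == nth 0 m i]%N)
     \prod_(c : cell l) x (T c) = x N ^+ (sumn l - sumn m) * schurv x m N.
Proof.
transitivity (\sum_(T in [set extend_filling S | S in [set S | semistandard S]])
     \prod_(c : cell l) x (T c)).
  by apply: eq_bigl => T; rewrite extend_image inE.
rewrite big_imset /= => [|? ? _ _ /extend_inj //].
rewrite big_set mulr_sumr; apply: eq_bigr => S _; exact: prod_extend.
Qed.

End Branching.

(** The cell above the last cell of row [i.+1] holds a strictly smaller letter, hence one below
    [N]. *)
Lemma interlace_row_count l N (T : filling l N.+1) i : semistandard T ->
  (nth 0 l i.+1 <= nth 0 l i)%N ->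
  (nth 0 l i.+1 <= row_count_below T i N)%N.
Proof.
move=> sT; case E: (nth 0%N l i.+1) => [//|q] lt_q.
have lt_q' : (q < nth 0 l i.+1)%N by rewrite E.
rewrite -[X in (X < _)%N](col_mkcell lt_q) -[X in row_count_below T X](row_mkcell lt_q).
rewrite -ltn_row_count //.
move/semistandardP: sT => [_ cT].
have := cT (mkcell lt_q) (mkcell lt_q') erefl (leqnn _).
by move/leq_trans; apply; rewrite -ltnS ltn_ord.
Qed.

(** The branching rule: tableaux are grouped by the shape that their letters below [N] occupy. *)
Lemma schurv_branch3 (R : comNzRingType) (x : nat -> R) p q r N :
  (r <= q)%N -> (q <= p)%N ->
  schurv x [:: p; q; r] N.+1 =
    \sum_(q <= p' < p.+1) \sum_(r <= q' < q.+1) \sum_(0 <= r' < r.+1)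
      x N ^+ ((p - p') + (q - q') + (r - r')) * schurv x [:: p'; q'; r'] N.
Proof.
move=> le_rq le_qp; set l := [:: p; q; r].
rewrite big_geq_mkord; under eq_bigr do
  (rewrite big_geq_mkord; under eq_bigr do rewrite big_mkord).
rewrite pair_big_dep /= pair_big_dep /= [LHS]/schurv.
(* By [cntT] the row counts do not exceed the row lengths, so [inord] loses nothing. *)
pose f (T : filling l N.+1) : 'I_p.+1 * 'I_q.+1 * 'I_r.+1 :=
  (inord (row_count_below T 0 N), inord (row_count_below T 1 N),
   inord (row_count_below T 2 N)).
have cntT (T : filling l N.+1) : [/\ row_count_below T 0 N <= p, row_count_below T 1 N <= q
                & row_count_below T 2 N <= r]%N.
  by split; [have := @row_count_le l _ T 0 N | have := @row_count_le l _ T 1 N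
            | have := @row_count_le l _ T 2 N].
rewrite (partition_big f (fun u => ((q <= u.1.1) && (r <= u.1.2)) && true)%N); last first.
  move=> T sT; have [c0 c1 c2] := cntT T; rewrite /= !inordK ?ltnS // andbT.
  by rewrite (@interlace_row_count l _ T 0) // (@interlace_row_count l _ T 1).
apply: eq_bigr => -[[p' q'] r'] /= /andP[/andP[le_q le_r] _].
have -> : (p - p' + (q - q') + (r - r') = sumn l - sumn [:: nat_of_ord p'; nat_of_ord q'; nat_of_ord r'])%N.
  by rewrite /l /=; have := ltn_ord p'; have := ltn_ord q'; have := ltn_ord r'; lia.
rewrite -schurv_branch_fixed; first last.
- by case=> [|[|[|i]]] //=; rewrite ?nth_nil.
- by case=> [|[|[|i]]] //=; rewrite ?nth_nil -1?ltnS ?ltn_ord.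
apply: eq_bigl => T; congr (_ && _); have [c0 c1 c2] := cntT T.
apply/eqP/forallP => [[<- <- <-] [[|[|[|i]]] //= _] | h].
- by rewrite inordK.
- by rewrite inordK.
- by rewrite inordK.
have h0 := h (@Ordinal 3 0 isT); have h1 := h (@Ordinal 3 1 isT).
have h2 := h (@Ordinal 3 2 isT).
by rewrite /f (eqP h0) (eqP h1) (eqP h2) /= !inord_val.
Qed.

(** * The Jacobi-Trudi formula for three rows *)

(** The complete homogeneous polynomial of degree [k] in [N] variables, split by the exponent of the
    last variable. *)
Fixpoint hv (R : comNzRingType) (x : nat -> R) (N k : nat) : R :=
  if N is N'.+1 then \sum_(0 <= m < k.+1) x N' ^+ (k - m) * hv x N' m else (k == 0%N)%:R.

Lemma hv0 (R : comNzRingType) (x : nat -> R) N : hv x N 0 = 1.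
Proof. by elim: N => [|N IH] //=; rewrite big_nat1 IH mulr1. Qed.

(** Coefficient form of [(1 - x_N t) H_(N+1)(t) = H_N(t)], where [H_N] is the generating series of
    [hv x N]. *)
Lemma hvS (R : comNzRingType) (x : nat -> R) N k :
  hv x N.+1 k.+1 = hv x N k.+1 + x N * hv x N.+1 k.
Proof.
rewrite /= big_nat_recr //= subnn expr0 mul1r addrC; congr (_ + _).
rewrite mulr_sumr !big_nat; apply: eq_bigr => m /andP[_ lt_m].
by rewrite mulrA -exprS subSn.
Qed.

Lemma eq_hv (R : comNzRingType) (x y : nat -> R) N k :
  (forall i, (i < N)%N -> x i = y i) -> hv x N k = hv y N k.
Proof.
elim: N k => //= N IH k eq_xy; apply: eq_bigr => m _.
by rewrite eq_xy // IH // => i lt_i; apply/eq_xy/leqW.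
Qed.

(* The index is shifted by two, so that hshift 0 and hshift 1 are h_(-2) and h_(-1). *)
Definition hshift (R : comNzRingType) (x : nat -> R) (N k : nat) : R :=
  if k is k'.+2 then hv x N k' else 0.

Arguments hshift : simpl never.

Lemma hshiftS (R : comNzRingType) (x : nat -> R) N k :
  hshift x N.+1 k.+1 = hshift x N k.+1 + x N * hshift x N.+1 k.
Proof.
case: k => [|[|k]]; rewrite /hshift ?mulr0 ?addr0 //; first by rewrite !hv0.
exact: hvS.
Qed.

(** The sum telescopes once [hshiftS] is applied to each term. *)
Lemma sum_hshift (R : comNzRingType) (x : nat -> R) N q p j : (q <= p)%N ->
  \sum_(q <= p' < p.+1) x N ^+ (p - p') * hshift x N (p' + j).+1
    = hshift x N.+1 (p + j).+1 - x N ^+ (p - q).+1 * hshift x N.+1 (q + j).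
Proof.
move=> /subnKC <-; elim: (p - q)%N => [|d IH].
  by rewrite addn0 subnn big_nat1 subnn hshiftS; ring.
rewrite addnS big_nat_recr ?leqW ?leq_addr //= subnn expr0 mul1r (addSn _ j) hshiftS.
have -> : \sum_(q <= i < (q + d).+1) x N ^+ ((q + d).+1 - i) * hshift x N (i + j).+1
   = x N * \sum_(q <= i < (q + d).+1) x N ^+ (q + d - i) * hshift x N (i + j).+1.
  rewrite mulr_sumr !big_nat; apply: eq_bigr => i /andP[_ lt_i].
  by rewrite subSn // exprS mulrA.
rewrite IH !subSn ?leq_addr // !exprS; ring.
Qed.

(** The same telescoping, without boundary term: at [r' = 0] the index is at most 2, that is degree
    at most 0, where [hshift] does not depend on [N]. *)
Lemma sum_hshift0 (R : comNzRingType) (x : nat -> R) N r j : (j <= 2)%N ->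
  \sum_(0 <= r' < r.+1) x N ^+ (r - r') * hshift x N (r' + j) = hshift x N.+1 (r + j).
Proof.
move=> le_j; elim: r => [|r IH].
  rewrite big_nat1 subnn mul1r !add0n.
  by case: j le_j => [|[|[|]]] //; rewrite /hshift !hv0.
rewrite big_nat_recr //= subnn mul1r addSn hshiftS -IH mulr_sumr addrC.
congr (_ + _); rewrite !big_nat; apply: eq_bigr => i /andP[_ lt_i].
by rewrite subSn // exprS mulrA.
Qed.

Definition det3 (R : comNzRingType) (a b c : nat -> R) : R :=
  a 0%N * (b 1%N * c 2%N - b 2%N * c 1%N)
  - a 1%N * (b 0%N * c 2%N - b 2%N * c 0%N)
  + a 2%N * (b 0%N * c 1%N - b 1%N * c 0%N).

Lemma eq_det3 (R : comNzRingType) (a b c a' b' c' : nat -> R) :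
  (forall j, (j <= 2)%N -> [/\ a j = a' j, b j = b' j & c j = c' j]) ->
  det3 a b c = det3 a' b' c'.
Proof.
move=> e; rewrite /det3.
by have [-> -> ->] := e 0%N isT; have [-> -> ->] := e 1%N isT; have [-> -> ->] := e 2%N isT.
Qed.

(** The determinant is linear in each row, so each sum is absorbed by its own row. *)
Lemma det3_sum (R : comNzRingType) (u v w : nat -> R) (a b c : nat -> nat -> R)
    (p0 p1 q0 q1 r0 r1 : nat) :
  \sum_(p0 <= p < p1) \sum_(q0 <= q < q1) \sum_(r0 <= r < r1)
     u p * v q * w r * det3 (a p) (b q) (c r)
  = det3 (fun j => \sum_(p0 <= p < p1) u p * a p j)
         (fun j => \sum_(q0 <= q < q1) v q * b q j)
         (fun j => \sum_(r0 <= r < r1) w r * c r j).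
Proof.
have sum_c a' b' : \sum_(r0 <= r < r1) w r * det3 a' b' (c r)
    = det3 a' b' (fun j => \sum_(r0 <= r < r1) w r * c r j).
  rewrite /det3 !mulr_sumr -!sumrB !mulr_sumr -!sumrB -big_split /=; apply: eq_bigr => r _; ring.
have sum_b a' c' : \sum_(q0 <= q < q1) v q * det3 a' (b q) c'
    = det3 a' (fun j => \sum_(q0 <= q < q1) v q * b q j) c'.
  rewrite /det3 !mulr_suml -!sumrB !mulr_sumr -!sumrB -big_split /=.
  by apply: eq_bigr => r _; ring.
have sum_a b' c' : \sum_(p0 <= p < p1) u p * det3 (a p) b' c'
    = det3 (fun j => \sum_(p0 <= p < p1) u p * a p j) b' c'.
  rewrite /det3 !mulr_suml -!sumrB -big_split /=.
  by apply: eq_bigr => r _; ring.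
rewrite -sum_a; apply: eq_bigr => p _; rewrite -sum_b mulr_sumr; apply: eq_bigr => q _.
by rewrite -sum_c !mulr_sumr; apply: eq_bigr => r _; rewrite !mulrA.
Qed.

(** With the shift by two undone, the rows are [h_(p+j)], [h_(q+j-1)] and [h_(r+j-2)] for
    [j = 0, 1, 2]. *)
Definition jacobi_trudi3 (R : comNzRingType) (x : nat -> R) N p q r : R :=
  det3 (fun j => hshift x N (p + j.+1).+1) (fun j => hshift x N (q + j).+1)
       (fun j => hshift x N (r + j)).

(** After summation, each of the first two rows is the row for [N.+1] minus a multiple of the next
    row for [N.+1]. These row operations leave the determinant unchanged. *)
Lemma jacobi_trudi3_branch (R : comNzRingType) (x : nat -> R) N p q r :
  (r <= q)%N -> (q <= p)%N ->
  jacobi_trudi3 x N.+1 p q r =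
    \sum_(q <= p' < p.+1) \sum_(r <= q' < q.+1) \sum_(0 <= r' < r.+1)
      x N ^+ ((p - p') + (q - q') + (r - r')) * jacobi_trudi3 x N p' q' r'.
Proof.
move=> le_rq le_qp.
under eq_bigr do under eq_bigr do under eq_bigr do rewrite !exprD.
rewrite (det3_sum (fun p' => x N ^+ (p - p')) (fun q' => x N ^+ (q - q'))
  (fun r' => x N ^+ (r - r')) (fun p' j => hshift x N (p' + j.+1).+1)
  (fun q' j => hshift x N (q' + j).+1) (fun r' j => hshift x N (r' + j))).
rewrite (eq_det3 (a' := fun j => hshift x N.+1 (p + j.+1).+1
                    - x N ^+ (p - q).+1 * hshift x N.+1 (q + j).+1)
  (b' := fun j => hshift x N.+1 (q + j).+1 - x N ^+ (q - r).+1 * hshift x N.+1 (r + j))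
  (c' := fun j => hshift x N.+1 (r + j))).
  rewrite /jacobi_trudi3 /det3; ring.
by move=> j le_j; split; rewrite ?sum_hshift0 ?sum_hshift // !addnS.
Qed.

Lemma schurv_noletter (R : comNzRingType) (x : nat -> R) l :
  schurv x l 0 = (sumn l == 0%N)%:R.
Proof.
rewrite -card_cells /schurv; case: (posnP #|cell l|) => [l0 | /card_gt0P[c _]].
  have no_c (c : cell l) : False by have /card0_eq/(_ c) := l0.
  pose T0 : filling l 0 := [ffun c => match no_c c with end].
  rewrite (big_pred1 T0) => [|T]; first by rewrite big1 // => c; case: (no_c c).
  have -> : T = T0 by apply/ffunP => c; case: (no_c c).
  by rewrite /= eqxx; apply/semistandardP; split=> c; case: (no_c c).
by rewrite big1 // => T; case: (T c).
Qed.

(** Both sides obey the same branching rule. With no letters both are 1 for the empty shape;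
    otherwise [p] is positive and the first row of the determinant vanishes. *)
Theorem schurv_jacobi_trudi3 (R : comNzRingType) (x : nat -> R) N p q r :
  (r <= q)%N -> (q <= p)%N -> schurv x [:: p; q; r] N = jacobi_trudi3 x N p q r.
Proof.
elim: N p q r => [|N IH] p q r le_rq le_qp; last first.
  rewrite schurv_branch3 // jacobi_trudi3_branch // !big_nat.
  apply: eq_bigr => p' /andP[le_p _]; rewrite !big_nat; apply: eq_bigr => q' /andP[le_q lt_q].
  by rewrite !big_nat; apply: eq_bigr => r' /andP[_ lt_r]; rewrite IH //; lia.
rewrite schurv_noletter /=; case: p le_qp => [|p le_qp].
  rewrite leqn0 => /eqP q0; move: le_rq; rewrite q0 leqn0 => /eqP->.
  by rewrite /jacobi_trudi3 /det3 /hshift /=; ring.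
by rewrite /jacobi_trudi3 /det3 /hshift !addnS !addSn /=; ring.
Qed.

Lemma schurv_hv (R : comNzRingType) (x : nat -> R) N k : schurv x [:: k] N = hv x N k.
Proof.
rewrite (@schurv_shape _ x _ [:: k; 0; 0]%N); last by case=> [|[|[|[]]]].
rewrite schurv_jacobi_trudi3 // /jacobi_trudi3 /det3 /hshift /= addn1 hv0; ring.
Qed.

Definition pv (R : comNzRingType) (x : nat -> R) N k : R := \sum_(i < N) x i ^+ k.

Lemma hv1 (R : comNzRingType) (x : nat -> R) N : hv x N 1 = pv x N 1.
Proof.
rewrite /pv; elim: N => [|N IH]; first by rewrite big_ord0.
by rewrite hvS IH hv0 big_ord_recr /= mulr1 expr1.
Qed.

(** This and [hv3] are Newton's identities, cleared of denominators so as to hold in every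
    commutative ring. *)
Lemma hv2 (R : comNzRingType) (x : nat -> R) N :
  hv x N 2 *+ 2 = pv x N 1 ^+ 2 + pv x N 2.
Proof.
elim: N => [|N IH]; first by rewrite /pv !big_ord0 /=; ring.
rewrite hvS mulrnDl IH hv1 /pv !big_ord_recr /=; ring.
Qed.

Lemma hv3 (R : comNzRingType) (x : nat -> R) N :
  hv x N 3 *+ 6 = pv x N 1 ^+ 3 + pv x N 1 * pv x N 2 *+ 3 + pv x N 3 *+ 2.
Proof.
elim: N => [|N IH]; first by rewrite /pv !big_ord0 /=; ring.
have h2 := hv2 x N.+1; rewrite hvS mulrnDl IH.
have -> : (x N * hv x N.+1 2) *+ 6 = x N *+ 3 * (hv x N.+1 2 *+ 2) by ring.
rewrite h2 /pv !big_ord_recr /=; ring.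
Qed.

Lemma schurv3 (R : comNzRingType) (x : nat -> R) N :
  schurv x [:: 3]%N N *+ 6 = pv x N 1 ^+ 3 + pv x N 1 * pv x N 2 *+ 3 + pv x N 3 *+ 2.
Proof. by rewrite schurv_hv hv3. Qed.

Lemma schurv21 (R : comNzRingType) (x : nat -> R) N :
  schurv x [:: 2; 1]%N N *+ 6 = pv x N 1 ^+ 3 *+ 2 - pv x N 3 *+ 2.
Proof.
rewrite (@schurv_shape _ x _ [:: 2; 1; 0]%N); last by case=> [|[|[|[]]]].
rewrite schurv_jacobi_trudi3 // /jacobi_trudi3 /det3 /hshift /= !hv0 hv1.
transitivity (pv x N 1 *+ 3 * (hv x N 2 *+ 2) - hv x N 3 *+ 6); first by ring.
rewrite hv2 hv3; ring.
Qed.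

Lemma schurv111 (R : comNzRingType) (x : nat -> R) N :
  schurv x [:: 1; 1; 1]%N N *+ 6
    = pv x N 1 ^+ 3 - pv x N 1 * pv x N 2 *+ 3 + pv x N 3 *+ 2.
Proof.
rewrite schurv_jacobi_trudi3 // /jacobi_trudi3 /det3 /hshift /= !hv0 hv1.
transitivity (pv x N 1 ^+ 3 *+ 6 - pv x N 1 *+ 6 * (hv x N 2 *+ 2) + hv x N 3 *+ 6);
  first by ring.
rewrite hv2 hv3; ring.
Qed.
Arguments hv : simpl never.

(** * Plethysm by a complete homogeneous function *)

Lemma comp_psum m N k (y : m.-tuple {mpoly rat[N]}) :
  psum k m \mPo y = pv (nth 0 y) m k.
Proof.
rewrite /psum rmorph_sum; apply: eq_bigr => i _.
by rewrite rmorphXn /= comp_mpolyXU.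
Qed.

Lemma comp_mpoly_comp m k N (P : {mpoly rat[m]}) (lp : m.-tuple {mpoly rat[k]})
    (lq : k.-tuple {mpoly rat[N]}) :
  (P \mPo lp) \mPo lq = P \mPo [tuple (tnth lp i) \mPo lq | i < m].
Proof.
rewrite [P \mPo lp]comp_mpolyEX [RHS]comp_mpolyEX raddf_sum; apply: eq_bigr => u _ /=.
rewrite comp_mpolyZ; congr (_ *: _).
rewrite !comp_mpolyX rmorph_prod; apply: eq_bigr => i _ /=.
by rewrite rmorphXn tnth_mktuple.
Qed.

Lemma psum_plethysm_hsym k n N :
  psum_plethysm k (hsym n) N = hv (fun i => mvar N i ^+ k) N n.
Proof.
rewrite /psum_plethysm /hsym comp_schur schurv_hv; apply: eq_hv => i lt_i.
by rewrite (nth_mktuple _ _ (Ordinal lt_i)) (mvarE (Ordinal lt_i)).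
Qed.

(* As h_n is a sum of distinct monomials, plethysm by h_n substitutes these
   monomials for the variables; hence its value does not depend on which
   expression in power sums the epsilon operator selects. *)
Lemma plethysm_hsym (l : seq nat) (n N : nat) :
  (exists P, psum_expression (schur l) P) ->
  exists y : nat -> {mpoly rat[N]}, exists M : nat,
    plethysm (schur l) (hsym n) N = schurv y l M /\
    forall k, pv y M k = hv (fun i => mvar N i ^+ k) N n.
Proof.
move=> exP; rewrite /plethysm.
have := epsilon_spec (inhabits (Tagged (fun m => {mpoly rat[m]}) (0 : {mpoly rat[0]})))
  _ exP.
move: (epsilon _ _) => [m P] /= hP.
pose E := [seq T <- index_enum (filling [:: n] N) | semistandard T].
pose s := [seq \prod_(c : cell [:: n]) mvar N (T c) | T : filling [:: n] N <- E].
pose y := in_tuple s; exists (nth 0 y), (size s).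
have pvy k : pv (nth 0 y) (size s) k = hv (fun i => mvar N i ^+ k) N n.
  rewrite -schurv_hv /pv /schurv -[RHS]big_filter -/E.
  rewrite -(big_mkord xpredT (fun i => (nth 0 s i) ^+ k)).
  rewrite -(big_nth 0 xpredT (fun z => z ^+ k)) big_map /=.
  by apply: eq_bigr => T _; rewrite prodrXl.
split=> //; rewrite -comp_schur hP comp_mpoly_comp; congr (_ \mPo _).
apply: eq_mktuple => i; rewrite tnth_mktuple comp_psum pvy.
exact: psum_plethysm_hsym.
Qed.

(** The integers are the values of an irreducible character of the symmetric group on 3 letters
    times the class sizes 1, 3, 2. Quantifying over all rings and variables allows evaluation at the
    monomials of [h_n]. *)
Definition cubic_power_sums (l : seq nat) (a b c : int) : Prop :=
  forall (R : comNzRingType) (x : nat -> R) N,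
    schurv x l N *+ 6 = a%:~R * pv x N 1 ^+ 3 + b%:~R * (pv x N 1 * pv x N 2)
                        + c%:~R * pv x N 3.

Lemma cubic_power_sums3 : cubic_power_sums [:: 3]%N 1 3 2.
Proof. by move=> R x N; rewrite schurv3; ring. Qed.

Lemma cubic_power_sums21 : cubic_power_sums [:: 2; 1]%N 2 0 (-2).
Proof. by move=> R x N; rewrite schurv21; ring. Qed.

Lemma cubic_power_sums111 : cubic_power_sums [:: 1; 1; 1]%N 1 (-3) 2.
Proof. by move=> R x N; rewrite schurv111; ring. Qed.

(** This is the existence that the [epsilon] in [plethysm] requires; the factor 6 is inverted in
    [rat]. *)
Lemma cubic_psum_expression l a b c : cubic_power_sums l a b c ->
  exists P, psum_expression (schur l) P.
Proof.
move=> hl.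
pose v (i : 'I_3) : {mpoly rat[3]} := 'X_i.
exists (Tagged (fun m => {mpoly rat[m]}) (6%:R^-1 *: (a%:~R * v 0 ^+ 3
  + b%:~R * (v 0 * v 1) + c%:~R * v 2%:R))) => N /=.
have psumE k : psum k N = pv (mvar N) N k by apply: eq_bigr => i _; rewrite mvarE.
have vE i : v i \mPo [tuple psum i.+1 N | i < 3] = pv (mvar N) N i.+1.
  by rewrite comp_mpolyXU nth_mktuple psumE.
rewrite comp_mpolyZ !rmorphD !(rmorphXn, rmorphM) !rmorph_int /= !vE -hl schurE.
by rewrite -scaler_nat scalerA mulVf ?scale1r.
Qed.

(** Here [g k] is [p_k[h_n]], the [k]-th power sum of the monomials of [h_n]. *)
Lemma plethysm_cubic l a b c n N : cubic_power_sums l a b c ->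
  let g k := hv (fun i => mvar N i ^+ k) N n in
  plethysm (schur l) (hsym n) N *+ 6
    = a%:~R * g 1%N ^+ 3 + b%:~R * (g 1%N * g 2%N) + c%:~R * g 3%N.
Proof.
move=> hl g; have [y [M [-> pvy]]] := plethysm_hsym n N (cubic_psum_expression hl).
by rewrite hl !pvy.
Qed.

(** * Power sum plethysms *)

(** Congruence modulo [X^M]; truncated polynomials stand in for power series. *)
Definition eqmodX (R : nzRingType) (M : nat) (p q : {poly R}) : Prop :=
  forall k, (k < M)%N -> p`_k = q`_k.

Lemma eqmodXD (R : nzRingType) M (p q p' q' : {poly R}) :
  eqmodX M p p' -> eqmodX M q q' -> eqmodX M (p + q) (p' + q').
Proof. by move=> ep eq k lt_k; rewrite !coefD ep ?eq. Qed.

Lemma eqmodXN (R : nzRingType) M (p p' : {poly R}) :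
  eqmodX M p p' -> eqmodX M (- p) (- p').
Proof. by move=> ep k lt_k; rewrite !coefN ep. Qed.

Lemma eqmodXM (R : nzRingType) M (p q p' q' : {poly R}) :
  eqmodX M p p' -> eqmodX M q q' -> eqmodX M (p * q) (p' * q').
Proof.
move=> ep eq k lt_k; rewrite !coefM; apply: eq_bigr => i _.
by rewrite ep ?eq //; have := ltn_ord i; lia.
Qed.

(** The factor has constant term 1, so it is invertible modulo [X^M]; concretely, each coefficient
    is determined by the earlier ones. *)
Lemma eqmodX_cancel (R : comNzRingType) M m (a : R) (p q : {poly R}) : (0 < m)%N ->
  eqmodX M ((1 - a *: 'X^m) * p) ((1 - a *: 'X^m) * q) -> eqmodX M p q.
Proof.
move=> m_gt0 e; elim/ltn_ind => k IH lt_k; have := e k lt_k.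
rewrite !mulrBl !mul1r -!scalerAl !coefB !coefZ !coefXnM.
case: ltnP => le_k; first by rewrite mulr0 !subr0.
by rewrite (IH (k - m)%N); [move/addIr | lia | lia].
Qed.

Section PowerPlethysm.
Variables (R : comNzRingType) (M : nat).
Hypothesis M_gt0 : (0 < M)%N.

(** The part of [H(t)] in degrees congruent to [c] modulo [m]. Working with these parts avoids roots
    of unity, which [R] may not contain. *)
Definition hpart (m c : nat) (x : nat -> R) (N : nat) : {poly R} :=
  \poly_(k < M) (if (k %% m == c)%N then hv x N k else 0).

(** The truncation of [p_m[H](t^m)]. *)
Definition hpower (m : nat) (x : nat -> R) (N : nat) : {poly R} :=
  \poly_(k < M) (if (m %| k)%N then hv (fun i => x i ^+ m) N (k %/ m) else 0).

(** The identity [H_N = (1 - x_N t) H_(N+1)] sorted by residues: multiplication by ['X] moves the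
    residue [c'] to [c]. *)
Lemma hpart_branch m c c' x N : (1 < m)%N -> (c < m)%N -> (c' < m)%N ->
  (c = c'.+1 %% m)%N ->
  eqmodX M (hpart m c x N) (hpart m c x N.+1 - x N *: ('X * hpart m c' x N.+1)).
Proof.
move=> m_gt1 lt_c lt_c' ec k lt_k; rewrite coefB coefZ coefXM !coef_poly lt_k.
case: k lt_k => [|k] lt_k /=; first by rewrite !hv0 mulr0 subr0.
rewrite (ltnW lt_k).
have -> : ((k.+1 %% m == c) = (k %% m == c'))%N.
  rewrite ec -[k.+1]addn1 -[c'.+1]addn1 eqn_modDr.
  by rewrite (modn_small lt_c').
by case: ifP => _; rewrite ?mulr0 ?subr0 // hvS addrK.
Qed.

Lemma hpower_branch m x N : (0 < m)%N ->
  eqmodX M (hpower m x N) ((1 - x N ^+ m *: 'X^m) * hpower m x N.+1).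
Proof.
move=> m_gt0 k lt_k; rewrite mulrBl mul1r -scalerAl coefB coefZ coefXnM !coef_poly lt_k.
case: ltnP => [lt_km | le_mk].
  rewrite mulr0 subr0; case: ifP => // /dvdnP[[|q] ek]; first by rewrite ek mul0n div0n !hv0.
  by move: lt_km; rewrite ek mulSn; lia.
rewrite (leq_ltn_trans (leq_subr m k) lt_k) dvdn_subl //.
case: ifP => [/dvdnP[[|q] ek] | _]; last by rewrite mulr0 subr0.
  by move: le_mk; rewrite ek mul0n leqn0 => /eqP m0; rewrite m0 in m_gt0.
have -> : (k %/ m = q.+1)%N by rewrite ek mulnK.
have -> : ((k - m) %/ m = q)%N by rewrite ek mulSn addKn mulnK.
by rewrite hvS addrK.
Qed.

Lemma hpart_noletter m c x : (c < m)%N -> hpart m c x 0 = (c == 0%N)%:R.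
Proof.
move=> lt_c; apply/polyP => -[|k].
  rewrite coef_poly M_gt0 mod0n /= eq_sym; case: eqP => _; last by rewrite coef0.
  by rewrite coef1.
rewrite coef_poly /= if_same; case: (c == 0%N); last by rewrite coef0 if_same.
by rewrite coef1 if_same.
Qed.

Lemma hpower_noletter m x : (0 < m)%N -> hpower m x 0 = 1.
Proof.
move=> m_gt0; apply/polyP => -[|k]; first by rewrite coef_poly M_gt0 dvdn0 div0n coef1.
rewrite coef_poly coef1 /=; case: ifP => // _; case: ifP => // /dvdnP[[|q] ek].
  by rewrite mul0n in ek.
by rewrite ek mulnK.
Qed.

(* H(t) H(-t), in terms of the even and odd parts of H(t) *)
Definition hnorm2 x N : {poly R} := hpart 2 0 x N ^+ 2 - hpart 2 1 x N ^+ 2.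

(* H(t) H(wt) H(w^2 t), w a primitive cube root of unity: a circulant determinant *)
Definition hnorm3 x N : {poly R} :=
  hpart 3 0 x N ^+ 3 + hpart 3 1 x N ^+ 3 + hpart 3 2 x N ^+ 3
  - 3%:R * (hpart 3 0 x N * hpart 3 1 x N * hpart 3 2 x N).

(** Passing from [N.+1] to [N] variables multiplies both sides by [1 - x_N^2 t^2]. On the left,
    [(e, o)] becomes [(e - x_N t o, o - x_N t e)], and the form [e^2 - o^2] acquires this factor. *)
Lemma hnorm2E x N : eqmodX M (hnorm2 x N) (hpower 2 x N).
Proof.
elim: N => [|N IH].
  by rewrite /hnorm2 !hpart_noletter // hpower_noletter // => k _; rewrite expr0n subr0 expr1n.
apply: (@eqmodX_cancel _ _ 2 (x N ^+ 2)) => // k lt_k.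
rewrite -hpower_branch // -IH //.
have e0 := @hpart_branch 2 0 1 x N isT isT isT erefl.
have e1 := @hpart_branch 2 1 0 x N isT isT isT erefl.
have -> := eqmodXD (eqmodXM e0 e0) (eqmodXN (eqmodXM e1 e1)) lt_k.
rewrite /hnorm2 -!mul_polyC rmorphXn /=; congr (nth _ (polyseq _) _); ring.
Qed.

(** As for [hnorm2E]: the circulant determinant is multiplicative, and its value on [1 - x_N t] is
    [1 - x_N^3 t^3]. *)
Lemma hnorm3E x N : eqmodX M (hnorm3 x N) (hpower 3 x N).
Proof.
elim: N => [|N IH].
  rewrite /hnorm3 !hpart_noletter // hpower_noletter // => k _.
  by congr (nth _ (polyseq _) _) => /=; ring.
apply: (@eqmodX_cancel _ _ 3 (x N ^+ 3)) => // k lt_k.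
rewrite -hpower_branch // -IH //.
have e0 := @hpart_branch 3 0 2 x N isT isT isT erefl.
have e1 := @hpart_branch 3 1 0 x N isT isT isT erefl.
have e2 := @hpart_branch 3 2 1 x N isT isT isT erefl.
have cube (p q : {poly R}) : eqmodX M p q -> eqmodX M (p ^+ 3) (q ^+ 3).
  by move=> e; rewrite !exprS !mulr1; do !apply: eqmodXM => //.
have e3 : eqmodX M (3%:R : {poly R}) 3%:R by [].
have -> := eqmodXD (eqmodXD (eqmodXD (cube _ _ e0) (cube _ _ e1)) (cube _ _ e2))
  (eqmodXN (eqmodXM e3 (eqmodXM (eqmodXM e0 e1) e2))) lt_k.
rewrite /hnorm3 -!mul_polyC rmorphXn /=; congr (nth _ (polyseq _) _); ring.
Qed.

End PowerPlethysm.

Lemma hv_sqr (R : comNzRingType) (x : nat -> R) N n :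
  hv (fun i => x i ^+ 2) N n = (hnorm2 (2 * n).+1 x N)`_(2 * n).
Proof. by rewrite hnorm2E // coef_poly leqnn dvdn_mulr // mulKn. Qed.

Lemma hv_cube (R : comNzRingType) (x : nat -> R) N n :
  hv (fun i => x i ^+ 3) N n = (hnorm3 (3 * n).+1 x N)`_(3 * n).
Proof. by rewrite hnorm3E // coef_poly leqnn dvdn_mulr // mulKn. Qed.

(** * Schur expansions of the plethysms *)

(** In a weakly decreasing list the zeros come last, so removing them shifts no other entry. *)
Lemma nth_positive_part l i : sorted geq l ->
  nth 0%N [seq k <- l | (0 < k)%N] i = nth 0%N l i.
Proof.
elim: l i => //= k l IH i pl; case: posnP => [k0 | _]; last first.
  by case: i => //= i; apply: IH; apply: path_sorted pl.
have /allP l0 : all (fun j => j == 0%N) (k :: l).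
  rewrite /= k0 eqxx /=; move: pl; rewrite (path_sortedE) => [/andP[h _] | a b c].
    by apply: sub_all h => j; rewrite /= k0 leqn0.
  by rewrite /geq /= => h1 h2; apply: leq_trans h1.
have -> : [seq j <- l | (0 < j)%N] = [::].
  apply/eqP; rewrite -[_ == _]negbK -has_filter; apply/hasPn => j lj.
  by rewrite (eqP (l0 j _)) // inE lj orbT.
rewrite nth_nil; case: (ltnP i (size (k :: l))) => [lt_i | /(nth_default 0%N) -> //].
by rewrite (eqP (l0 _ (mem_nth 0%N lt_i))).
Qed.

Lemma positive_part_intpart l : sorted geq l -> is_intpart [seq k <- l | (0 < k)%N].
Proof.
move=> sl; rewrite /is_intpart mem_filter andbT sorted_filter //.
by move=> a b c h1 h2; apply: leq_trans h1.
Qed.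

Definition to_intpart l (sl : sorted geq l) : intpart :=
  exist (fun l => is_intpart l) _ (positive_part_intpart sl).

Lemma schur_to_intpart l (sl : sorted geq l) N :
  schur (val (to_intpart sl)) N = schur l N.
Proof. by rewrite !schurE; apply: schurv_shape => i; apply: nth_positive_part. Qed.

(** The bounds on size and number of rows are those under which a two-row multiplicity can be read
    off in two variables. Repetitions in the list are allowed, so sums are concatenations. *)
Definition schur_span (d : nat) (f : symfun) : Prop :=
  exists2 s : seq (rat * intpart),
    forall u, u \in s -> (size (val u.2) <= 3)%N /\ sumn (val u.2) = d
  & forall N, f N = \sum_(u <- s) u.1 *: schur (val u.2) N.

Lemma eq_schur_span d (f g : symfun) :
  (forall N, f N = g N) -> schur_span d f -> schur_span d g.
Proof. by move=> e [s hs es]; exists s => // N; rewrite -e. Qed.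

Lemma schur_span0 d : schur_span d (fun _ => 0).
Proof. by exists [::] => // N; rewrite big_nil. Qed.

Lemma schur_spanD d f g :
  schur_span d f -> schur_span d g -> schur_span d (fun N => f N + g N).
Proof.
move=> [s hs es] [t ht et]; exists (s ++ t) => [u | N].
  by rewrite mem_cat => /orP[/hs | /ht].
by rewrite big_cat es et.
Qed.

Lemma schur_spanZ d (a : rat) f : schur_span d f -> schur_span d (fun N => a *: f N).
Proof.
move=> [s hs es]; exists [seq (a * u.1, u.2) | u <- s] => [u /mapP[v /hs h ->] // | N].
rewrite big_map es scaler_sumr; apply: eq_bigr => u _; by rewrite scalerA.
Qed.

Lemma schur_spanN d f : schur_span d f -> schur_span d (fun N => - f N).
Proof.
by move=> hf; apply: eq_schur_span (schur_spanZ (-1) hf) => N; rewrite scaleN1r.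
Qed.

Lemma schur_span_sum d n (F : nat -> symfun) :
  (forall i, (i < n)%N -> schur_span d (F i)) ->
  schur_span d (fun N => \sum_(i < n) F i N).
Proof.
elim: n => [|n IH] hF.
  by apply: eq_schur_span (schur_span0 d) => N; rewrite big_ord0.
apply: (@eq_schur_span _ (fun N => \sum_(i < n) F i N + F n N)).
  by move=> N; rewrite big_ord_recr.
by apply: schur_spanD; [apply: IH => i lt_i; apply/hF/leqW | apply: hF].
Qed.

Definition hshiftX N k : {mpoly rat[N]} := hshift (mvar N) N k.

(* Jacobi-Trudi expresses h_p h_q h_r (p >= q >= r) as a Schur function plus
   products whose index triples have a larger sum of squares. *)
Lemma schur_span_hshift d A B C : (A + B + C = d + 6)%N ->
  schur_span d (fun N => hshiftX N A * hshiftX N B * hshiftX N C).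
Proof.
(* The 6 comes from three indices shifted by two. The sum of squares is at most the square of the
   sum, which makes the difference a valid measure. *)
have [m] := ubnP ((d + 6) * (d + 6) - (A * A + B * B + C * C))%N.
elim: m A B C => // m IH A B C.
wlog: A B C / (C <= B)%N && (B <= A)%N.
  move=> wl lt_m eABC.
  have ord : exists A' B' C', [/\ (C' <= B') && (B' <= A'), A' + B' + C' = A + B + C,
      A' * A' + B' * B' + C' * C' = A * A + B * B + C * C
      & (forall N, hshiftX N A' * hshiftX N B' * hshiftX N C'
                   = hshiftX N A * hshiftX N B * hshiftX N C)%R]%N.
    case: (leqP B A) => AB; case: (leqP C B) => BC; case: (leqP C A) => AC.
    all: try by (exists A, B, C; split; [lia | lia | lia | move=> N; ring]).
    all: try by (exists A, C, B; split; [lia | lia | lia | move=> N; ring]).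
    all: try by (exists B, A, C; split; [lia | lia | lia | move=> N; ring]).
    all: try by (exists B, C, A; split; [lia | lia | lia | move=> N; ring]).
    all: try by (exists C, A, B; split; [lia | lia | lia | move=> N; ring]).
    all: try by (exists C, B, A; split; [lia | lia | lia | move=> N; ring]).
  have [A' [B' [C' [so e1 e2 e3]]]] := ord.
  by apply: eq_schur_span e3 _; apply: wl => //; [rewrite e2 | rewrite e1].
(* A shifted index below 2 is a negative degree, and the product is 0. *)
case: (ltnP C 2) => [C2 _ _ _ | C2].
  apply: eq_schur_span (schur_span0 d) => N.
  by case: C C2 => [|[]] // _; rewrite [X in _ * X]/hshiftX /hshift mulr0.
move=> /andP[CB BA]; have B2 := leq_trans C2 CB; have A2 := leq_trans B2 BA.
case: C B A C2 CB B2 BA A2 => [|[|r]] // [|[|q]] // [|[|p]] // _ le_rq _ le_qp _ lt_m eABC.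
rewrite !ltnS in le_rq le_qp.
have sl : sorted geq [:: p; q; r] by rewrite /= /geq /= le_rq le_qp.
have hpqr : schur_span d (schur [:: p; q; r]).
  exists [:: (1, to_intpart sl)] => [u | N].
    rewrite inE => /eqP->; rewrite size_filter; split; first exact: count_size.
    have -> : sumn (val (1 : rat, to_intpart sl).2) = sumn [:: p; q; r].
      by rewrite /=; do 3 case: posnP => [->|_]; rewrite /= ?add0n.
    by move: eABC; rewrite /=; lia.
  by rewrite big_seq1 scale1r schur_to_intpart.
have hABC A B C : (A + B + C = d + 6)%N ->
    (p.+2 * p.+2 + q.+2 * q.+2 + r.+2 * r.+2 < A * A + B * B + C * C)%N ->
    schur_span d (fun N => hshiftX N A * hshiftX N B * hshiftX N C).
  move=> e lt_sq; apply: IH => //.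
  have : (A * A + B * B + C * C <= (d + 6) * (d + 6))%N by rewrite -e; nia.
  by lia.
(* The five terms of the determinant other than the diagonal one, with opposite signs because they
   change sides. *)
have h1 := hABC p.+2 q.+3 r.+1; have h2 := hABC p.+3 q.+1 r.+2.
have h3 := schur_spanN (hABC p.+3 q.+3 r _ _).
have h4 := schur_spanN (hABC p.+4 q.+1 r.+1 _ _).
have h5 := hABC p.+4 q.+2 r.
have all5 := schur_spanD hpqr (schur_spanD (schur_spanD (h1 _ _) (h2 _ _))
   (schur_spanD (schur_spanD (h3 _ _) (h4 _ _)) (h5 _ _))).
apply: eq_schur_span (all5 _ _ _ _ _ _ _ _ _ _); try lia.
move=> N; rewrite schurE schurv_jacobi_trudi3 // /jacobi_trudi3 /det3 -!/(hshiftX _ _).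
rewrite ?(addn0, addn1, addn2, addn3); ring.
Qed.

Definition hX N k : {mpoly rat[N]} := hv (mvar N) N k.

Lemma schur_span_h d a b c : (a + b + c = d)%N ->
  schur_span d (fun N => hX N a * hX N b * hX N c).
Proof. by move=> e; apply: (@schur_span_hshift d a.+2 b.+2 c.+2); lia. Qed.

Lemma schur_span_if d (t : bool) f g : schur_span d f -> schur_span d g ->
  schur_span d (fun N => if t then f N else g N).
Proof. by case: t. Qed.

Lemma schur_span_hpart3 d M c1 c2 c3 : (d < M)%N ->
  schur_span d (fun N => (hpart M 3 c1 (mvar N) N * hpart M 3 c2 (mvar N) N
                           * hpart M 3 c3 (mvar N) N)`_d).
Proof.
move=> lt_d.
pose F i j (N : nat) : {mpoly rat[N]} := if [&& j %% 3 == c1, (i - j) %% 3 == c2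
  & (d - i) %% 3 == c3]%N then hX N j * hX N (i - j) * hX N (d - i) else 0.
apply: (@eq_schur_span _ (fun N => \sum_(i < d.+1) \sum_(j < i.+1) F i j N)).
  move=> N; rewrite coefM; apply: eq_bigr => i _; rewrite coefM mulr_suml.
  apply: eq_bigr => j _; rewrite !coef_poly /F.
  have := ltn_ord i; have := ltn_ord j; rewrite !ltnS => le_j le_i.
  rewrite !(leq_ltn_trans _ lt_d) ?leq_subr //; [ | lia | lia].
  by do 3 case: (_ == _); rewrite ?(mulr0, mul0r).
apply: (@schur_span_sum _ _ (fun i N => \sum_(j < i.+1) F i j N)) => i lt_i.
apply: (@schur_span_sum _ _ (F i)) => j lt_j.
apply: (schur_span_if _ _ (schur_span0 d)); apply: schur_span_h; lia.
Qed.

Lemma schur_span_plethysm l a b c n : cubic_power_sums l a b c ->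
  schur_span (3 * n) (plethysm (schur l) (hsym n)).
Proof.
move=> hl; pose g k N : {mpoly rat[N]} := hv (fun i => mvar N i ^+ k) N n.
have g1E N : g 1%N N = hX N n by apply: eq_hv => i _; rewrite expr1.
have s1 : schur_span (3 * n) (fun N => g 1%N N ^+ 3).
  apply: eq_schur_span (@schur_span_h (3 * n) n n n _) => [N|]; last by lia.
  by rewrite g1E; ring.
have s2 : schur_span (3 * n) (fun N => g 1%N N * g 2%N N).
  pose F c i (N : nat) : {mpoly rat[N]} :=
    if (i %% 2 == c)%N && ((2 * n - i) %% 2 == c)%N
    then hX N n * hX N i * hX N (2 * n - i) else 0.
  apply: (@eq_schur_span _ (fun N => \sum_(i < (2 * n).+1) F 0%N i N
                                     - \sum_(i < (2 * n).+1) F 1%N i N)).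
    move=> N; rewrite g1E /g hv_sqr /hnorm2 coefB !expr2 !coefM mulrBr !mulr_sumr.
    congr (_ - _); apply: eq_bigr => i _; rewrite !coef_poly /F.
      rewrite ltn_ord ltnS leq_subr.
      by do 2 case: (_ == _); rewrite ?(mulr0, mul0r) // mulrA.
    rewrite ltn_ord ltnS leq_subr.
    by do 2 case: (_ == _); rewrite ?(mulr0, mul0r) // mulrA.
  have sF c' i : (i < (2 * n).+1)%N -> schur_span (3 * n) (F c' i).
    move=> lt_i; apply: (schur_span_if _ _ (schur_span0 _)); apply: schur_span_h; lia.
  by apply: schur_spanD; [|apply: schur_spanN];
     [apply: (@schur_span_sum _ _ (F 0%N)) | apply: (@schur_span_sum _ _ (F 1%N))] => i; apply: sF.
have s3 : schur_span (3 * n) (g 3%N).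
  have sh c1 c2 c3 := @schur_span_hpart3 (3 * n) (3 * n).+1 c1 c2 c3 (leqnn _).
  apply: eq_schur_span (schur_spanD (schur_spanD (schur_spanD (sh 0 0 0)%N (sh 1 1 1)%N)
    (sh 2 2 2)%N) (schur_spanZ (- 3%:R) (sh 0 1 2)%N)) => N.
  rewrite /g hv_cube /hnorm3 coefB !coefD !exprS !mulr1 !mulrA scaleNr; congr (_ - _).
  by rewrite scaler_nat -!mulrA mulr_natl coefMn.
apply: eq_schur_span (schur_spanZ 6%:R^-1 (schur_spanD (schur_spanD
  (schur_spanZ a%:~R s1) (schur_spanZ b%:~R s2)) (schur_spanZ c%:~R s3))) => N.
have zE (z : int) (y : {mpoly rat[N]}) : z%:~R *: y = z%:~R * y.
  by rewrite scaler_int mulrzl.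
rewrite !zE -(plethysm_cubic n N hl).
by rewrite -scaler_nat scalerA mulVf ?scale1r.
Qed.

(** * Uniqueness of Schur expansions *)

Lemma card_ltn_sum (I : finType) (f : I -> nat) k :
  #|[set c | (f c < k)%N]| = (\sum_(i < k) #|[set c | f c == i]|)%N.
Proof.
elim: k => [|k IH]; first by rewrite big_ord0; apply: eq_card0 => c; rewrite inE.
rewrite big_ord_recr /= -IH -cardsUI.
have -> : [set c | (f c < k)%N] :&: [set c | f c == k] = set0.
  by apply/setP => c; rewrite !inE; apply/negbTE; apply/andP; lia.
rewrite cards0 addn0; apply: eq_card => c; rewrite !inE ltnS leq_eqVlt orbC.
by [].
Qed.

Lemma card_row l i : #|[set c : cell l | row_of c == i]| = nth 0%N l i.
Proof.
rewrite -[RHS]minnn -card_row_prefix; apply: eq_card => c; rewrite !inE.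
by case: eqP => // <-; rewrite ltn_col.
Qed.

(** The coefficients of Schur polynomials are the Kostka numbers. *)
Lemma mcoeff_schur l N (u : 'X_{1..N}) : (schur l N)@_u = #|SSYT l u|%:R.
Proof.
rewrite /schur raddf_sum -sum1_card natr_sum /=.
rewrite [RHS](eq_bigl (fun T => semistandard T && [forall a, content T a == u a])).
  rewrite [RHS]big_mkcondr /=; apply: eq_bigr => T _ /=.
  rewrite mprodXE mcoeffX; set v := (X in X == u).
  have -> : (v == u) = [forall a, content T a == u a].
    have vE a : v a = content T a.
      rewrite mnm_sumE /content -sum1_card big_mkcond [RHS]big_mkcond /=.
      by apply: eq_bigr => c _; rewrite mnm1E inE; case: eqP.
    apply/eqP/forallP => [<- a | h]; first by rewrite vE.
    by apply/mnmP => a; rewrite vE; apply/eqP.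
  by case: ifP.
by move=> T; rewrite inE.
Qed.

Lemma sorted_nth_geq (l : seq nat) i j : sorted geq l -> (i <= j)%N ->
  (nth 0 l j <= nth 0 l i)%N.
Proof.
move=> sl le_ij; case: (ltnP j (size l)) => [lt_j | /(nth_default 0%N) -> //].
have tr : transitive geq by move=> a b c h1 h2; apply: leq_trans h1.
have := @sorted_leq_nth _ _ tr (fun x => leqnn x) 0%N _ sl i j.
by apply=> //; rewrite inE //; apply: leq_ltn_trans lt_j.
Qed.

Lemma semistandard_row_le l N (T : filling l N) (c : cell l) :
  sorted geq l -> semistandard T -> (row_of c <= T c)%N.
Proof.
move=> sl /semistandardP[_ cT]; move: {2}(row_of c) (erefl (row_of c)) => i.
elim: i c => [|i IH] c ec; first by rewrite ec.
have lt_c : (col_of c < nth 0 l i)%N.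
  by apply: leq_trans (ltn_col c) _; apply: sorted_nth_geq; rewrite // ec.
rewrite ec; apply: leq_ltn_trans (IH (mkcell lt_c) erefl) _.
by apply: cT; rewrite // row_mkcell ec.
Qed.

Definition partial_sum (l : seq nat) k : nat := (\sum_(i < k) nth 0 l i)%N.

(** By column strictness a letter is at least its row index, so the cells with letter below [k] lie
    in the first [k] rows. *)
Lemma SSYT_dominance N (l m : seq nat) k : sorted geq m -> (k <= N)%N ->
  SSYT m (fun i : 'I_N => nth 0%N l i) != set0 ->
  (partial_sum l k <= partial_sum m k)%N.
Proof.
move=> sm le_k /set0Pn[T]; rewrite inE => /andP[sT /forallP cT].
have -> : partial_sum l k = #|[set c : cell m | (T c < k)%N]|.
  rewrite card_ltn_sum; apply: eq_bigr => i _.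
  have /eqP <- := cT (widen_ord le_k i).
  by apply: eq_card => c; rewrite !inE.
have -> : partial_sum m k = #|[set c : cell m | (row_of c < k)%N]|.
  by rewrite card_ltn_sum; apply: eq_bigr => i _; rewrite card_row.
apply/subset_leq_card/subsetP => c; rewrite !inE; apply: leq_ltn_trans.
exact: semistandard_row_le.
Qed.

Lemma SSYT_superstandard N (l : seq nat) : (size l <= N)%N ->
  SSYT l (fun i : 'I_N => nth 0%N l i) != set0.
Proof.
move=> le_N; pose T : filling l N := [ffun c => widen_ord le_N (tag c)].
have TE c : T c = row_of c :> nat by rewrite ffunE.
apply/set0Pn; exists T; rewrite inE; apply/andP; split.
  by apply/semistandardP; split=> c d e; rewrite !TE ?e.
apply/forallP => a; rewrite -card_row; apply/eqP/eq_card => c.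
by rewrite !inE -(TE c).
Qed.

Lemma intpart_ext (l m : intpart) :
  (forall i, nth 0%N (val l) i = nth 0%N (val m) i) -> l = m.
Proof.
move=> e; apply: val_inj.
have le_size (l' m' : intpart) : (forall i, nth 0%N (val l') i = nth 0%N (val m') i) ->
    (size (val l') <= size (val m'))%N.
  move=> e'; rewrite leqNgt; apply/negP => lt_s.
  have /andP[_ /negP] := valP l'; apply.
  by rewrite -(nth_default 0%N (leqnn (size (val m')))) -e' mem_nth.
apply: (@eq_from_nth _ 0%N); last by move=> i _; apply: e.
by apply/eqP; rewrite eqn_leq !le_size.
Qed.

Lemma leq_sum_eq n (F G : nat -> nat) : (forall i, (i < n)%N -> (F i <= G i)%N) ->
  (\sum_(i < n) G i <= \sum_(i < n) F i)%N -> forall i, (i < n)%N -> F i = G i.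
Proof.
elim: n => // n IH le_FG; rewrite !big_ord_recr.
rewrite -[X in (X <= _)%N -> _]/(\sum_(i < n) G i + G n)%N.
rewrite -[X in (_ <= X)%N -> _]/(\sum_(i < n) F i + F n)%N => le_sum.
have le_n := le_FG n (leqnn _).
have le_FG' i : (i < n)%N -> (F i <= G i)%N by move=> lt_i; apply/le_FG/leqW.
have le_s : (\sum_(i < n) F i <= \sum_(i < n) G i)%N.
  by apply: leq_sum => i _; apply: le_FG'.
move=> i; rewrite ltnS leq_eqVlt => /orP[/eqP-> | lt_i]; first by lia.
by apply: IH => //; lia.
Qed.

(** The total of the partial sums is a rank function for dominance: it increases strictly unless the
    two partitions agree. *)
Lemma dominance_eq N (l m : intpart) :
  (size (val l) <= N)%N -> (size (val m) <= N)%N ->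
  (forall k, (k <= N)%N -> (partial_sum (val l) k <= partial_sum (val m) k)%N) ->
  (\sum_(k < N.+1) partial_sum (val m) k <= \sum_(k < N.+1) partial_sum (val l) k)%N ->
  l = m.
Proof.
move=> sl sm dom le_s; have e := @leq_sum_eq N.+1 _ _ dom le_s.
apply: intpart_ext => i; case: (ltnP i N) => [lt_i | le_N]; last first.
  by rewrite !nth_default //; [apply: leq_trans le_N | apply: leq_trans le_N].
have := e i.+1 lt_i; rewrite /partial_sum !big_ord_recr /=.
by have := e i (leqW lt_i); rewrite /partial_sum => ->; apply: addnI.
Qed.

(** Kostka numbers are unitriangular for dominance; here only a nonzero diagonal is needed. The
    coefficient at the monomial of exponent [l] involves only shapes dominating [l], and induction
    goes downwards along the rank [Phi]. *)
Lemma schur_free (S : {fset intpart}) (D : intpart -> rat) :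
  (forall N, \sum_(l <- S) D l *: schur (val l) N = 0) ->
  forall l, l \in S -> D l = 0.
Proof.
(* Enough variables for all rows of every partition in [S]. *)
move=> D0; pose N := (\sum_(l <- S) size (val l))%N.
have le_N l : l \in S -> (size (val l) <= N)%N.
  by move=> lS; rewrite /N (big_fsetD1 l) //= leq_addr.
pose Phi (l : intpart) := (\sum_(k < N.+1) partial_sum (val l) k)%N.
pose B := (\sum_(l <- S) Phi l)%N.
have le_B l : l \in S -> (Phi l <= B)%N.
  by move=> lS; rewrite /B (big_fsetD1 l) //= leq_addr.
move=> l; have [k] := ubnP (B - Phi l)%N; elim: k l => // k IH l lt_k lS.
pose u : 'X_{1..N} := [multinom nth 0%N (val l) i | i < N].
have := congr1 (mcoeff u) (D0 N); rewrite mcoeff0 raddf_sum (big_fsetD1 l) //=.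
rewrite big_seq big1 => [|m]; last first.
  rewrite !inE => /andP[ne_ml mS]; rewrite mcoeffZ mcoeff_schur.
  have [-> | neS] := eqVneq (SSYT (val m) u) set0; first by rewrite cards0 mulr0.
  rewrite IH ?mul0r //.
  have neS' : SSYT (val m) (fun i : 'I_N => nth 0%N (val l) i) != set0.
    case/set0Pn: neS => T; rewrite inE => /andP[sT /forallP cT].
    apply/set0Pn; exists T; rewrite inE sT; apply/forallP => a.
    by rewrite (eqP (cT a)) mnmE.
  have lt_Phi : (Phi l < Phi m)%N.
    rewrite ltnNge; apply: contra ne_ml => le_Phi; apply/eqP/esym.
    apply: (@dominance_eq N) => //; [exact: le_N | exact: le_N |].
    move=> i le_i; apply: (@SSYT_dominance N) => //.
    by have /andP[] := valP m.
  by have := le_B m mS; lia.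
rewrite addr0 mcoeffZ mcoeff_schur => /eqP; rewrite mulf_eq0 => /orP[/eqP // |].
rewrite pnatr_eq0 cards_eq0 => /eqP S0; have := SSYT_superstandard (le_N l lS).
case/set0Pn => T; rewrite inE => /andP[sT /forallP cT].
have : T \in SSYT (val l) u.
  by rewrite inE sT; apply/forallP => a; rewrite (eqP (cT a)) mnmE.
by rewrite S0 inE.
Qed.

Lemma schur_expansion_uniq f a b :
  schur_expansion f a -> schur_expansion f b -> a = b.
Proof.
move=> ha hb; pose S := (finsupp a `|` finsupp b)%fset.
have expand (c : {fsfun intpart -> rat with 0}) N : (finsupp c `<=` S)%fset ->
    \sum_(l <- finsupp c) c l *: schur (val l) N = \sum_(l <- S) c l *: schur (val l) N.
  move=> sub_c; apply: big_fset_incl => // l _ /fsfun_dflt ->; exact: scale0r.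
have D0 : forall l, l \in S -> a l - b l = 0.
  apply: (@schur_free S (fun l => a l - b l)) => N.
  under eq_bigr do rewrite scalerBl.
  rewrite sumrB -!expand ?fsubsetUl ?fsubsetUr //.
  by rewrite -ha -hb subrr.
apply/fsfunP => l; case: (boolP (l \in S)) => [/D0/eqP | ].
  by rewrite subr_eq0 => /eqP.
by rewrite inE negb_or => /andP[/fsfun_dflt -> /fsfun_dflt ->].
Qed.

(** Uniqueness of the expansion pins down the choice made by [epsilon]. *)
Lemma schur_coordE f a : schur_expansion f a -> schur_coord f = a.
Proof.
move=> ha; apply: (@schur_expansion_uniq f) => //.
exact: (epsilon_spec (inhabits [fsfun]) (schur_expansion f) (ex_intro _ a ha)).
Qed.

Definition list_coord (s : seq (rat * intpart)) : {fsfun intpart -> rat with 0} :=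
  [fsfun l in seq_fset tt [seq u.2 | u <- s] => \sum_(u <- s | u.2 == l) u.1].

Lemma list_coordE s l : list_coord s l = \sum_(u <- s | u.2 == l) u.1.
Proof.
rewrite fsfun_fun seq_fsetE; case: ifPn => // /mapP no_l.
rewrite big_seq_cond big1 // => u /andP[us /eqP ul].
by case: no_l; exists u.
Qed.

Lemma list_coord_expansion (f : symfun) s :
  (forall N, f N = \sum_(u <- s) u.1 *: schur (val u.2) N) ->
  schur_expansion f (list_coord s).
Proof.
move=> fE N; set S := seq_fset tt [seq u.2 | u <- s].
rewrite (@big_fset_incl _ _ _ _ _ S); first last.
- by move=> l _ /fsfun_dflt ->; rewrite scale0r.
- exact: finsupp_sub.
under eq_bigr do rewrite list_coordE scaler_suml big_mkcond.
have inS u : u \in s -> u.2 \in S by move=> us; rewrite seq_fsetE map_f.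
clearbody S; rewrite fE exchange_big /= big_seq [RHS]big_seq; apply: eq_bigr => u us.
have uS := inS u us.
rewrite (big_fsetD1 u.2) //= eqxx big_seq big1 ?addr0 // => l.
by rewrite !inE eq_sym => /andP[/negPf-> _].
Qed.

Lemma hall_schur (l : intpart) (f : symfun) g s :
  (forall N, f N = schur (val l) N) ->
  (forall N, g N = \sum_(u <- s) u.1 *: schur (val u.2) N) ->
  hall f g = \sum_(u <- s | u.2 == l) u.1.
Proof.
move=> fE gE; rewrite /hall.
have fE' N : f N = \sum_(u <- [:: (1 : rat, l)]) u.1 *: schur (val u.2) N.
  by rewrite big_seq1 scale1r.
rewrite (schur_coordE (list_coord_expansion fE')) (schur_coordE (list_coord_expansion gE)).
rewrite -(list_coordE s) (@big_fset_incl _ _ _ _ _ [fset l]%fset); first last.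
- by move=> m _ /fsfun_dflt ->; rewrite mul0r.
- by apply/fsubsetP => m /(fsubsetP (finsupp_sub _ _ _)); rewrite seq_fsetE !inE.
by rewrite big_seq_fset1 list_coordE big_cons big_nil eqxx addr0 mul1r.
Qed.

(** * Multiplicities of two-row Schur functions *)

Lemma hv_two_letters k n :
  hv (fun i => ('X^i : {poly rat}) ^+ k) 2 n = \sum_(i < n.+1) 'X^(k * i).
Proof.
have hv_one m : hv (fun i => ('X^i : {poly rat}) ^+ k) 1 m = 1.
  elim: m => [|m IH]; first by rewrite hv0.
  by rewrite hvS IH mulr1 expr0 expr1n /hv /= add0r.
elim: n => [|n IH]; first by rewrite hv0 big_ord1 muln0.
rewrite hvS hv_one IH mulr_sumr [RHS]big_ord_recl /= muln0; congr (_ + _).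
by apply: eq_bigr => i _; rewrite expr1 -exprD mulnS.
Qed.

Lemma geometricX k : (1 - 'X) * \sum_(i < k) 'X^i = 1 - 'X^k :> {poly rat}.
Proof.
elim: k => [|k IH]; first by rewrite big_ord0 mulr0 subrr.
by rewrite big_ord_recr /= mulrDr IH exprS; ring.
Qed.

(** At the values 1 and ['X] every [h_k] is [(1 - 'X^(k+1)) / (1 - 'X)], and the Jacobi-Trudi
    determinant becomes explicit; it vanishes for three nonempty rows. *)
Lemma schurv_two_letters p q r : (r <= q)%N -> (q <= p)%N ->
  (1 - 'X) * schurv (fun i => 'X^i) [:: p; q; r] 2
    = (r == 0%N)%:R * ('X^q - 'X^(p.+1)) :> {poly rat}.
Proof.
move=> le_rq le_qp; rewrite schurv_jacobi_trudi3 //.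
have X1 : (1 - 'X : {poly rat}) != 0.
  apply/eqP => /(congr1 (fun p : {poly rat} => p.[0])); rewrite !hornerE => /eqP.
  by rewrite oner_eq0.
have hE k : (1 - 'X) * hshift (fun i => 'X^i) 2 k.+1 = 1 - 'X^k :> {poly rat}.
  case: k => [|k]; first by rewrite /hshift mulr0 subrr.
  rewrite /hshift -geometricX; congr (_ * _).
  rewrite (@eq_hv _ _ (fun i => 'X^i ^+ 1)) => [|i _]; last by rewrite expr1.
  by rewrite hv_two_letters; apply: eq_bigr => i _; rewrite mul1n.
(* With the factor already present this gives [(1 - 'X)^3], one factor for each entry of a term of
   the determinant. *)
apply: (mulfI (expf_neq0 2 X1)).
case: r le_rq => [|r] le_rq.
  rewrite /jacobi_trudi3 /det3 !add0n; set H := hshift _ _.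
  have [H0 H1] : H 0%N = 0 /\ H 1%N = 0 by [].
  have H2 : H 2%N = 1 by rewrite /H /hshift hv0.
  rewrite H0 H1 H2.
  transitivity ((1 - 'X) * (((1 - 'X) * H (p + 1).+1) * ((1 - 'X) * H (q + 1).+1)
     - ((1 - 'X) * H (p + 2).+1) * ((1 - 'X) * H (q + 0).+1))); first by ring.
  by rewrite !hE eqxx mul1r !addnS !addn0 !exprS; ring.
rewrite /jacobi_trudi3 /det3 !addSn; set H := hshift _ _.
transitivity (((1 - 'X) * H (p + 1).+1) * (((1 - 'X) * H (q + 1).+1) * ((1 - 'X) * H (r + 2).+1)
    - ((1 - 'X) * H (q + 2).+1) * ((1 - 'X) * H (r + 1).+1))
  - ((1 - 'X) * H (p + 2).+1) * (((1 - 'X) * H (q + 0).+1) * ((1 - 'X) * H (r + 2).+1)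
    - ((1 - 'X) * H (q + 2).+1) * ((1 - 'X) * H (r + 0).+1))
  + ((1 - 'X) * H (p + 3).+1) * (((1 - 'X) * H (q + 0).+1) * ((1 - 'X) * H (r + 1).+1)
    - ((1 - 'X) * H (q + 1).+1) * ((1 - 'X) * H (r + 0).+1))); first by ring.
by rewrite !hE !addnS !addn0 !exprS /=; ring.
Qed.

Definition eval2 : {mpoly rat[2]} -> {poly rat} :=
  mmap (@polyC rat) (fun i : 'I_2 => 'X^i).

HB.instance Definition _ := GRing.RMorphism.on eval2.

Lemma eval2Z a p : eval2 (a *: p) = a *: eval2 p.
Proof. by rewrite /eval2 mmapZ mul_polyC. Qed.

Lemma eval2_mvar i : (i < 2)%N -> eval2 (mvar 2 i) = 'X^i.
Proof. by move=> lt_i; rewrite (mvarE (Ordinal lt_i)) /eval2 mmapX mmap1U. Qed.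

Lemma rmorph_hv (R S : comNzRingType) (f : {rmorphism R -> S}) x N k :
  f (hv x N k) = hv (f \o x) N k.
Proof. by rewrite -!schurv_hv rmorph_schurv. Qed.

Lemma sumn3 (l : seq nat) : (size l <= 3)%N ->
  sumn l = (nth 0 l 0 + nth 0 l 1 + nth 0 l 2)%N.
Proof. by case: l => [|a [|b [|c []]]] //=; lia. Qed.

(** For at most two rows the product is ['X^q - 'X^(p+1)]. Since [p] is at least half of [3 * n],
    hence at least [j], only ['X^q] can contribute, and [q = j] characterizes [lam]. *)
Lemma eval2_schur n j (l lam : intpart) : (2 * j <= 3 * n)%N ->
  (forall i, nth 0%N (val lam) i = nth 0%N [:: 3 * n - j; j]%N i) ->
  (size (val l) <= 3)%N -> sumn (val l) = (3 * n)%N ->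
  ((1 - 'X) * eval2 (schur (val l) 2))`_j = (l == lam)%:R.
Proof.
move=> le_j lamE sz_l sum_l; have /andP[sl _] := valP l.
set p := nth 0%N (val l) 0; set q := nth 0%N (val l) 1; set r := nth 0%N (val l) 2.
have pqr : (p + q + r = 3 * n)%N by rewrite -sum_l sumn3.
have le_rq : (r <= q)%N by apply: sorted_nth_geq.
have le_qp : (q <= p)%N by apply: sorted_nth_geq.
have l_lam : (l == lam) = (q == j) && (r == 0%N).
  apply/eqP/andP => [el | [/eqP eq /eqP er]].
    by rewrite /q /r el !lamE.
  apply: intpart_ext => i; rewrite lamE; case: i => [|[|[|i]]] /=.
  - by rewrite -/p; lia.
  - exact: eq.
  - exact: er.
  by rewrite !nth_default // (leq_trans sz_l).
rewrite schurE rmorph_schurv (@eq_schurv _ _ (fun i => 'X^i)); last first.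
  by move=> i lt_i; rewrite /= eval2_mvar.
rewrite (@schurv_shape _ _ _ [:: p; q; r]); last first.
  by case=> [|[|[|i]]] //=; rewrite !nth_default // (leq_trans sz_l).
rewrite schurv_two_letters // l_lam; case: (r =P 0%N) => [r0 | _]; last first.
  by rewrite mul0r coef0 andbF.
rewrite mul1r coefB !coefXn andbT (eq_sym q) (_ : (j == p.+1) = false) ?subr0 //.
by apply/negbTE/eqP; lia.
Qed.

Lemma hall_two_row n j (g : symfun) : (2 * j <= 3 * n)%N -> schur_span (3 * n) g ->
  hall (schur (two_row n j)) g = ((1 - 'X) * eval2 (g 2))`_j.
Proof.
move=> le_j [s hs gE].
have sl : sorted geq (two_row n j) by rewrite /= /geq /= andbT; lia.
have lamE i : nth 0%N (val (to_intpart sl)) i = nth 0%N (two_row n j) i.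
  exact: nth_positive_part.
rewrite (@hall_schur (to_intpart sl) _ g s) // => [|N]; last by rewrite schur_to_intpart.
rewrite gE raddf_sum mulr_sumr coef_sum big_mkcond big_seq [RHS]big_seq.
apply: eq_bigr => u /hs[sz_u sum_u].
rewrite /= eval2Z -scalerAr coefZ (@eval2_schur n j _ (to_intpart sl)) //.
by case: eqP => _; rewrite ?mulr1 ?mulr0.
Qed.

(** This is [p_k[h_n]] at the variables 1 and ['X]. *)
Definition geom n k : {poly rat} := \sum_(i < n.+1) 'X^(k * i).

Lemma hall_plethysm_cubic l a b c n j : cubic_power_sums l a b c -> (2 * j <= 3 * n)%N ->
  hall (schur (two_row n j)) (plethysm (schur l) (hsym n)) *+ 6
    = a%:~R * ((1 - 'X) * geom n 1 ^+ 3)`_j + b%:~R * ((1 - 'X) * (geom n 1 * geom n 2))`_j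
      + c%:~R * ((1 - 'X) * geom n 3)`_j.
Proof.
move=> hl le_j; rewrite (hall_two_row le_j (schur_span_plethysm n hl)).
have gE k : eval2 (hv (fun i => mvar 2 i ^+ k) 2 n) = geom n k.
  rewrite rmorph_hv /geom -hv_two_letters; apply: eq_hv => i lt_i.
  by rewrite /= rmorphXn /= eval2_mvar.
pose f : {rmorphism {mpoly rat[2]} -> {poly rat}} := eval2.
have evE (u v w : {mpoly rat[2]}) :
    eval2 (a%:~R * u ^+ 3 + b%:~R * (u * v) + c%:~R * w)
      = a%:~R * eval2 u ^+ 3 + b%:~R * (eval2 u * eval2 v) + c%:~R * eval2 w.
  by rewrite -!/(f _) 2!(rmorphD f) !(rmorphM f) !(rmorph_int f).
have pE : eval2 (plethysm (schur l) (hsym n) 2) *+ 6 = a%:~R * geom n 1 ^+ 3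
    + b%:~R * (geom n 1 * geom n 2) + c%:~R * geom n 3.
  rewrite -!gE -evE -[LHS](raddfMn f); congr (f _).
  exact: (plethysm_cubic n 2 hl).
have cE (z : int) (y : {poly rat}) : ((1 - 'X) * (z%:~R * y))`_j = z%:~R * ((1 - 'X) * y)`_j.
  by rewrite mulrCA !mulrzl coefMrz.
by rewrite -coefMn -mulrnAr pE !mulrDr !coefD !cE.
Qed.

(** * Two-row tableaux of content (n,n,n) *)

Lemma card_two_rows p q (P : pred (cell [:: p; q])) :
  #|[set c | P c]| = (#|[set c | (row_of c == 0%N) && P c]|
                      + #|[set c | (row_of c == 1%N) && P c]|)%N.
Proof.
rewrite -cardsUI (_ : _ :&: _ = set0).
  rewrite cards0 addn0; apply: eq_card => c; rewrite !inE -andb_orl.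
  by have := ltn_row c; case: (row_of c) => [|[|]].
by apply/setP => c; rewrite !inE; case: (row_of c) => [|]; rewrite ?andbF.
Qed.

Section TwoRow.
Variables (n j : nat).
Hypothesis le_j : (2 * j <= 3 * n)%N.

Let l := two_row n j.

Let sorted_l : sorted geq l.
Proof. by rewrite /l /= /geq /= andbT; lia. Qed.

Definition type_of_counts (j a b : nat) : option (seq (seq nat)) :=
  let low := (a < b./2)%N || ((a == b./2) && (j %% 3 == 0)%N) in
  let high := (a > b./2)%N || ((a == b./2) && (j %% 3 == 1)%N) in
  if ~~ odd a && low then Some t123
  else if ~~ odd a && high then Some t12_3
  else if odd a && low then Some t1_2_3
  else if odd a && high then Some t13_2
  else None.

(** For [a] entries 2 in the second row: at most [n] entries 3 are there, and that row is no longer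
    than the [2 * n - a] entries 1 and 2 of the first. With [a <= j] this also gives [a <= n]. *)
Definition admissible (a : nat) : bool := (j <= n + a)%N && (a + j <= 2 * n)%N.

Lemma content_cumulative (T : filling l 3) :
  [forall a, content T a == n] <->
  forall k, (k <= 3)%N -> #|[set c | (T c < k)%N]| = (k * n)%N.
Proof.
have contE (a : 'I_3) : content T a = #|[set c | nat_of_ord (T c) == a]|.
  by apply: eq_card => c; rewrite !inE.
split=> [/forallP cT k le_k | cT].
  rewrite card_ltn_sum (eq_bigr (fun=> n)) ?sum_nat_const ?card_ord // => i _.
  by have /eqP <- := cT (widen_ord le_k i); rewrite contE.
apply/forallP => a; rewrite contE; apply/eqP.
have := cT a.+1 (ltn_ord a); have := cT a (ltnW (ltn_ord a)).
by rewrite !card_ltn_sum big_ord_recr /= => -> ; rewrite mulSn; lia.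
Qed.

Section Given.
Variable T : filling l 3.
Hypothesis ssT : T \in SSYT l (fun _ : 'I_3 => n).

Let sT : semistandard T.
Proof. by move: ssT; rewrite inE => /andP[]. Qed.

Let cT k : (k <= 3)%N -> #|[set c | (T c < k)%N]| = (k * n)%N.
Proof. by move: ssT; rewrite inE => /andP[_ /content_cumulative]; apply. Qed.

Lemma row1_count1 : row_count_below T 1 1 = 0%N.
Proof.
apply: eq_card0 => c; rewrite !inE; case: eqP => // rc.
by have := semistandard_row_le c sorted_l sT; rewrite rc => h; apply/negbTE; lia.
Qed.

Lemma row1_count2 : row_count_below T 1 2 = k22 T.
Proof.
apply: eq_card => c; rewrite !inE; case: eqP => //= rc.
have := semistandard_row_le c sorted_l sT; rewrite rc /= => h.
by apply/idP/eqP; lia.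
Qed.

Lemma k22_k32 : (k22 T + k32 T = j)%N.
Proof.
rewrite -[RHS]/(nth 0 l 1)%N -card_row -row1_count2 -cardsUI.
rewrite (_ : _ :&: _ = set0).
  rewrite cards0 addn0; apply: eq_card => c; rewrite !inE -andb_orr.
  by case: eqP => //= _; case: (T c) => [[|[|[|]]]].
apply/setP => c; rewrite !inE; case: eqP => //= _; apply/negbTE.
by apply/andP => -[h /eqP e]; rewrite e in h.
Qed.

Lemma row0_count1 : row_count_below T 0 1 = n.
Proof.
have := cT (isT : (1 <= 3)%N); rewrite mul1n (card_two_rows (fun c => (T c < 1)%N)).
by rewrite -/(row_count_below T 0 1) -/(row_count_below T 1 1) row1_count1 addn0.
Qed.

Lemma row0_count2 : (row_count_below T 0 2 + k22 T = 2 * n)%N.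
Proof.
have := cT (isT : (2 <= 3)%N); rewrite (card_two_rows (fun c => (T c < 2)%N)).
by rewrite -/(row_count_below T 0 2) -/(row_count_below T 1 2) row1_count2.
Qed.

Lemma admissible_k22 : admissible (k22 T).
Proof.
have := row0_count2; have := @row_count_le l _ T 0 2.
have : (nth 0 l 1 <= row_count_below T 0 2)%N.
  by apply: interlace_row_count => //; apply: sorted_nth_geq.
by rewrite /admissible /= => *; apply/andP; split; lia.
Qed.

End Given.

(** Rows as sums of step functions: the first changes letter at columns [n] and [2 * n - a]; the
    second starts at letter 1, in the numbering from 0, and changes at column [a]. *)
Definition tabval (a i x : nat) : nat :=
  if i == 0%N then ((n <= x) + (2 * n - a <= x))%N else (a <= x).+1%N.

Definition two_row_tab (a : nat) : filling l 3 := [ffun c => inord (tabval a (row_of c) (col_of c))].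

Lemma tabE a c : two_row_tab a c = tabval a (row_of c) (col_of c) :> nat.
Proof. by rewrite ffunE inordK // /tabval; case: ifP => _; lia. Qed.

(** The content fixes the row counts once [k22 T] is known, and by [ltn_row_count] these counts
    determine every entry. *)
Lemma tab_k22 T : T \in SSYT l (fun _ : 'I_3 => n) -> T = two_row_tab (k22 T).
Proof.
move=> ssT; have sT : semistandard T by move: ssT; rewrite inE => /andP[].
apply/ffunP => c; apply: val_inj; rewrite /= tabE.
have lt1 := ltn_row_count 1 c sT; have lt2 := ltn_row_count 2 c sT.
have := ltn_ord (T c); have := row0_count1 ssT; have := row0_count2 ssT.
have := row1_count1 ssT; have := row1_count2 ssT.
have := ltn_row c; move: lt1 lt2; rewrite /tabval; case: (row_of c) => [|[|]] //= lt1 lt2.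
  by move=> _ _ _ e2 e1 lt3; rewrite e1 in lt1; lia.
by move=> _ e2 e1 _ _ lt3; rewrite e1 in lt1; rewrite e2 in lt2; lia.
Qed.

Section Tab.
Variable a : nat.
Hypotheses (le_aj : (a <= j)%N) (adm_a : admissible a).

Let va : (j <= n + a)%N /\ (a + j <= 2 * n)%N.
Proof. exact/andP. Qed.

Lemma tab_row0 k : (k <= 3)%N ->
  #|[set c | (row_of c == 0%N) && (two_row_tab a c < k)%N]|
    = nth 0%N [:: 0; n; 2 * n - a; 3 * n - j]%N k.
Proof.
have [v1 v2] := va => le_k.
transitivity (minn (nth 0%N [:: 0; n; 2 * n - a; 3 * n - j]%N k) (nth 0 l 0)).
  rewrite -card_row_prefix; apply: eq_card => c; rewrite !inE tabE /tabval.
  case: eqP => //= rc; have := ltn_col c; rewrite rc /= => lt_c.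
  by move: k le_k => [|[|[|[|]]]] //= _; lia.
by move: k le_k => [|[|[|[|]]]] //= _; lia.
Qed.

Lemma tab_row1 k : (k <= 3)%N ->
  #|[set c | (row_of c == 1%N) && (two_row_tab a c < k)%N]| = nth 0%N [:: 0; 0; a; j]%N k.
Proof.
have [v1 v2] := va => le_k.
transitivity (minn (nth 0%N [:: 0; 0; a; j]%N k) (nth 0 l 1)).
  rewrite -card_row_prefix; apply: eq_card => c; rewrite !inE tabE /tabval.
  case: eqP => //= rc; have := ltn_col c; rewrite rc /= => lt_c.
  by move: k le_k => [|[|[|[|]]]] //= _; lia.
by move: k le_k => [|[|[|[|]]]] //= _; lia.
Qed.

Lemma tab_SSYT : two_row_tab a \in SSYT l (fun _ : 'I_3 => n).
Proof.
have [v1 v2] := va; rewrite inE; apply/andP; split.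
  apply/semistandardP; split=> c d e le_cd; rewrite !tabE.
    by rewrite e /tabval; case: ifP => _; lia.
  have := ltn_row c; have := ltn_row d; have := ltn_col d.
  move: le_cd; rewrite e /tabval; case: (row_of c) => [|[|]] //; case: (row_of d) => [|[|]] //=.
  by move=> _ lt_d _ _; lia.
apply/content_cumulative => k le_k; rewrite (card_two_rows (fun c => (two_row_tab a c < k)%N)).
rewrite tab_row0 // tab_row1 //; move: k le_k => [|[|[|[|]]]] //= _; lia.
Qed.

Lemma k22_tab : k22 (two_row_tab a) = a.
Proof. by rewrite -(row1_count2 tab_SSYT); apply: tab_row1. Qed.

End Tab.

(** The map [k22] is a bijection from the tableaux onto the admissible [a <= j], with inverse
    [two_row_tab]. *)
Lemma card_type t :
  #|[set T in @SSYT l 3 (fun _ => n) | tab_type T == Some t]|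
    = (\sum_(a < j.+1) (admissible a && (type_of_counts j a (j - a) == Some t)))%N.
Proof.
pose A := [set a : 'I_j.+1 | admissible a && (type_of_counts j a (j - a) == Some t)].
have -> : [set T in @SSYT l 3 (fun _ => n) | tab_type T == Some t] = [set two_row_tab (nat_of_ord a) | a in A].
  apply/setP => T; rewrite in_set; apply/andP/imsetP => [[ssT tT] | [a]].
    have kj := k22_k32 ssT; have lt_k : (k22 T < j.+1)%N by lia.
    exists (Ordinal lt_k); last exact: tab_k22.
    rewrite inE admissible_k22 //=.
    by have -> : (j - k22 T = k32 T)%N by lia.
  rewrite inE => /andP[va ta ->]; have le_a : (a <= j)%N by rewrite -ltnS.
  have ssT := tab_SSYT le_a va; split=> //.
  have := k22_k32 ssT; have := k22_tab le_a va => e1 e2.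
  have {}e2 : k32 (two_row_tab a) = (j - a)%N by lia.
  by rewrite -[tab_type _]/(type_of_counts j (k22 (two_row_tab a)) (k32 (two_row_tab a))) e1 e2.
rewrite card_in_imset => [|a b]; last first.
  rewrite !inE => /andP[va _] /andP[vb _] e; apply: val_inj => /=.
  by rewrite -(k22_tab _ va) -1?ltnS // e k22_tab // -ltnS.
rewrite -sum1_card -big_mkcond /=; apply: eq_bigl => a; by rewrite inE.
Qed.

End TwoRow.

(** * Comparison of the counts *)

Lemma coef_geom n k i : (0 < k)%N -> (geom n k)`_i = ((k %| i) && (i <= k * n))%N%:R.
Proof.
move=> k_gt0; rewrite /geom coef_sum.
have [/dvdnP[q ->] | ndvd] /= := boolP (k %| i)%N; last first.
  rewrite big1 // => m _; rewrite coefXn; case: eqP ndvd => // ->.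
  by rewrite dvdn_mulr.
rewrite (mulnC q) leq_pmul2l //.
under eq_bigr do rewrite coefXn eqn_pmul2l //.
elim: n => [|n IH]; first by rewrite big_ord1 leqn0.
rewrite big_ord_recr /= IH -natrD; congr (_%:R).
by lia.
Qed.

Lemma coef_geom3 n j : (j <= 3 * n)%N ->
  ((1 - 'X) * geom n 3)`_j = (3 %| j)%N%:R - ((0 < j) && (3 %| j.-1))%N%:R.
Proof.
move=> le_j; rewrite mulrBl mul1r coefB coefXM !coef_geom // le_j andbT.
case: j le_j => [|j] le_j //=.
by rewrite (ltnW le_j) andbT.
Qed.

Lemma geometric_geom n : (1 - 'X) * geom n 1 = 1 - 'X^(n.+1).
Proof.
by rewrite -geometricX; congr (_ * _); apply: eq_bigr => i _; rewrite mul1n.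
Qed.

Lemma coef_geom12 n j : (j <= 2 * n)%N ->
  ((1 - 'X) * (geom n 1 * geom n 2))`_j
    = (2 %| j)%N%:R - ((n < j) && (2 %| j - n.+1))%N%:R.
Proof.
move=> le_j; rewrite mulrA geometric_geom mulrBl mul1r coefB coefXnM !coef_geom // le_j andbT.
congr (_ - _); rewrite ltnS ltnNge; case: leqP => //= lt_nj.
by rewrite (_ : (_ <= 2 * n)%N = true) ?andbT //; lia.
Qed.

Lemma coef_geom1_sqr n i : (i <= 2 * n)%N ->
  (geom n 1 * geom n 1)`_i = (if i <= n then i.+1 else (2 * n).+1 - i)%N%:R.
Proof.
move=> le_i; rewrite coefM.
under eq_bigr do rewrite !coef_geom // !dvd1n !mul1n /= -natrM mulnb.
rewrite -natr_sum; congr (_%:R).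
(* The condition means [i - n <= m <= n]; counting over initial segments makes induction
   possible. *)
have cnt k : (k <= i.+1)%N ->
    (\sum_(m < k) ((m <= n) && (i - m <= n)))%N = (minn k n.+1 - (i - n))%N.
  elim: k => [|k IH] le_k; first by rewrite big_ord0 min0n.
  by rewrite big_ord_recr /= IH ?(ltnW le_k) //; lia.
by rewrite cnt //; case: leqP => h; lia.
Qed.

(** This coefficient is the multiplicity in [h_n^3], hence the number of all tableaux of the shape
    and content considered. *)
Lemma coef_geom111 n j : (2 * j <= 3 * n)%N ->
  ((1 - 'X) * geom n 1 ^+ 3)`_j = (if j <= n then j.+1 else (3 * n).+1 - 2 * j)%N%:R.
Proof.
move=> le_j; rewrite exprS mulrA geometric_geom mulrBl mul1r coefB coefXnM expr2.
rewrite !coef_geom1_sqr ?ltnS; [|lia|lia].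
case: (leqP j n) => lt_nj; first by rewrite subr0.
by rewrite ifT -?natrB; [congr (_%:R) | |]; lia.
Qed.

(** There are [uphalf k] even and [k./2] odd numbers below [k]; truncated subtraction covers empty
    intervals. *)
Lemma count_even k lo hi :
  (\sum_(a < k) [&& lo <= a, a < hi & ~~ odd a])%N
    = (uphalf (minn k hi) - uphalf (minn k lo))%N.
Proof.
elim: k => [|k IH]; first by rewrite big_ord0 !min0n.
by rewrite big_ord_recr /= IH; lia.
Qed.

Lemma count_odd k lo hi :
  (\sum_(a < k) [&& lo <= a, a < hi & odd a])%N = ((minn k hi)./2 - (minn k lo)./2)%N.
Proof.
elim: k => [|k IH]; first by rewrite big_ord0 !min0n.
by rewrite big_ord_recr /= IH; lia.
Qed.

(* For a + b = j, the condition on (a, b) is low exactly when a < threshold j. *)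
Definition threshold j : nat := (j %/ 3 + (j %% 3 != 1))%N.

(** Equality [a = (j - a)./2] means [j = 3a] or [j = 3a + 1], so the residue of [j] settles the tie
    and the low and high conditions are complementary. *)
Lemma type_of_countsE j a t : (a <= j)%N -> t \in SYT3 ->
  (type_of_counts j a (j - a) == Some t)
    = if t == t123 then (a < threshold j)%N && ~~ odd a
      else if t == t12_3 then (threshold j <= a)%N && ~~ odd a
      else if t == t1_2_3 then (a < threshold j)%N && odd a
      else (threshold j <= a)%N && odd a.
Proof.
move=> le_a; rewrite /type_of_counts.
have -> : ((a < (j - a)./2) || ((a == (j - a)./2) && (j %% 3 == 0)))%N = (a < threshold j)%N.
  by rewrite /threshold; lia.
have -> : ((a > (j - a)./2) || ((a == (j - a)./2) && (j %% 3 == 1)))%N = (threshold j <= a)%N.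
  by rewrite /threshold; lia.
rewrite !inE [(threshold j <= a)%N]leqNgt => /or4P[] /eqP->; by case: (odd a); case: (a < threshold j)%N.
Qed.

(** The boolean [e] selects the parity of [a]: even for [true], odd for [false]. *)
Lemma card_typeE n j t lo hi e : (2 * j <= 3 * n)%N -> t \in SYT3 ->
  (forall a, (a <= j)%N ->
     admissible n j a && (type_of_counts j a (j - a) == Some t)
       = [&& lo <= a, a < hi & odd a (+) e]%N) ->
  #|[set T in @SSYT (two_row n j) 3 (fun _ => n) | tab_type T == Some t]|
    = (if e then uphalf (minn j.+1 hi) - uphalf (minn j.+1 lo)
       else (minn j.+1 hi)./2 - (minn j.+1 lo)./2)%N.
Proof.
move=> le_j t3 h; rewrite card_type //.
rewrite (eq_bigr (fun a : 'I_j.+1 => nat_of_bool [&& lo <= a, a < hi & odd a (+) e]%N)).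
  by case: e {h}; rewrite -?count_even -?count_odd; apply: eq_bigr => a _;
     rewrite ?addbT ?addbF.
by move=> a _; rewrite h // -ltnS.
Qed.

Lemma thresholdE m s : (s < 6)%N ->
  threshold (6 * m + s) = (2 * m + s %/ 3 + (s %% 3 != 1))%N.
Proof. by case: s => [|[|[|[|[|[|]]]]]] //= _; rewrite /threshold; lia. Qed.

(** Six times each count, in the order [t123], [t1_2_3], [t12_3], [t13_2], equals the combination of
    [K], [p2 - m2] and [p3 - m3] given by the power sum coefficients. Negative terms are moved
    across so that the identities live in [nat]. *)
Lemma type_counts n j : (2 * j <= 3 * n)%N ->
  let W := minn j.+1 (threshold j) in
  let L := minn j.+1 (j - n) in
  let U := minn j.+1 (2 * n - j).+1 in
  let K := if (j <= n)%N then j.+1 else ((3 * n).+1 - 2 * j)%N in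
  let p2 := (2 %| j)%N in let m2 := ((n < j) && (2 %| j - n.+1))%N in
  let p3 := (3 %| j)%N in let m3 := ((0 < j) && (3 %| j.-1))%N in
  [/\ (uphalf W - uphalf L) * 6 + 3 * m2 + 2 * m3 = K + 3 * p2 + 2 * p3,
      (W./2 - L./2) * 6 + 3 * p2 + 2 * m3 = K + 3 * m2 + 2 * p3,
      (uphalf U - uphalf W) * 6 + 2 * p3 = 2 * K + 2 * m3
    & (U./2 - W./2) * 6 + 2 * p3 = 2 * K + 2 * m3]%N.
Proof.
move=> le_j /=.
(* For a fixed residue modulo 6, the halves and thirds of [j] are linear in [m], leaving linear
   arithmetic in each case. *)
have [m [s [ej lt_s]]] : exists m s, (j = 6 * m + s /\ s < 6)%N.
  by exists (j %/ 6)%N, (j %% 6)%N; lia.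
have -> : threshold j = (2 * m + s %/ 3 + (s %% 3 != 1))%N by rewrite ej thresholdE.
have -> : (3 %| j)%N = (s == 0%N) || (s == 3)%N.
  by rewrite ej; move: lt_s; clear; move: s => [|[|[|[|[|[|]]]]]] //= _; lia.
have -> : ((0 < j) && (3 %| j.-1))%N = (s == 1%N) || (s == 4)%N.
  by rewrite ej; move: lt_s; clear; move: s => [|[|[|[|[|[|]]]]]] //= _; lia.
have -> : (2 %| j)%N = ~~ odd s by rewrite ej; lia.
rewrite (minn_idPr (_ : 2 * m + _ + _ <= j.+1)%N); last by lia.
rewrite (minn_idPr (_ : j - n <= j.+1)%N); last by lia.
case: leqP => h.
  rewrite (_ : j - n = 0)%N ?(minn_idPl (_ : j.+1 <= _)%N) /=; [| lia | lia].
  by move: s lt_s ej => [|[|[|[|[|[|]]]]]] //= _ ej; split; lia.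
rewrite (minn_idPr (_ : _ <= j.+1)%N) /= ?dvdn2 ?oddB; [| lia | lia].
by move: s lt_s ej => [|[|[|[|[|[|]]]]]] //= _ ej; split; lia.
Qed.

Theorem mainTheorem1 (n j : nat) (n_gt0 : (0 < n)%N) (j_le : (j <= (3 * n) %/ 2)%N)
    (t : seq (seq nat)) (t_SYT3 : t \in SYT3) :
  #|[set T in @SSYT (two_row n j) 3 (fun _ => n) | tab_type T == Some t]|%:R
    = hall (schur (two_row n j)) (plethysm (schur (seq.shape t)) (hsym n)).
Proof.
have le_j : (2 * j <= 3 * n)%N by lia.
have le_j2 : (j <= 2 * n)%N by lia.
have le_j3 : (j <= 3 * n)%N by lia.
pose W := threshold j; pose L := (j - n)%N; pose U := (2 * n - j).+1.
have cubic a b c (cnt : nat) : cubic_power_sums (seq.shape t) a b c ->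
    cnt%:R *+ 6 = a%:~R * ((1 - 'X) * geom n 1 ^+ 3)`_j
      + b%:~R * ((1 - 'X) * (geom n 1 * geom n 2))`_j + c%:~R * ((1 - 'X) * geom n 3)`_j ->
    cnt%:R = hall (schur (two_row n j)) (plethysm (schur (seq.shape t)) (hsym n)).
  move=> ht e; apply: (mulIf (_ : 6%:R != 0 :> rat)) => //; rewrite !mulr_natr e.
  exact/esym/hall_plethysm_cubic.
(* For low types the upper bound [a <= 2 * n - j] follows from [a < W] and [le_j], so [a] runs from
   [L] to [W], excluded. *)
have card_low e : t = (if e then t123 else t1_2_3) ->
   #|[set T in @SSYT (two_row n j) 3 (fun _ => n) | tab_type T == Some t]|
    = (if e then uphalf (minn j.+1 W) - uphalf (minn j.+1 L)
       else (minn j.+1 W)./2 - (minn j.+1 L)./2)%N.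
  move=> te; apply: card_typeE => // a le_a; rewrite type_of_countsE // te /admissible.
  by rewrite /W /L /threshold; case: e {te} => /=; lia.
(* For high types the lower bound [j - n <= a] follows from [W <= a] and [le_j], so [a] runs from
   [W] to [U], excluded. *)
have card_high e : t = (if e then t12_3 else t13_2) ->
   #|[set T in @SSYT (two_row n j) 3 (fun _ => n) | tab_type T == Some t]|
    = (if e then uphalf (minn j.+1 U) - uphalf (minn j.+1 W)
       else (minn j.+1 U)./2 - (minn j.+1 W)./2)%N.
  move=> te; apply: card_typeE => // a le_a; rewrite type_of_countsE // te /admissible.
  by rewrite /W /U /threshold; case: e {te} => /=; lia.
rewrite coef_geom111 // coef_geom12 // coef_geom3 // in cubic.
have [c123 c1_2_3 c12_3 c13_2] := type_counts le_j.
have toR (u v : nat) : u = v -> u%:R = v%:R :> rat by move->.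
move: t_SYT3; rewrite !inE => /or4P[] /eqP te.
- rewrite (card_low true te).
  apply: (cubic 1 3 2); first by rewrite te; apply: cubic_power_sums3.
  by move/toR: c123; rewrite !natrD !natrM -mulr_natr; lra.
- rewrite (card_high true te).
  apply: (cubic 2 0 (-2)); first by rewrite te; apply: cubic_power_sums21.
  by move/toR: c12_3; rewrite !natrD !natrM -mulr_natr; lra.
- rewrite (card_high false te).
  apply: (cubic 2 0 (-2)); first by rewrite te; apply: cubic_power_sums21.
  by move/toR: c13_2; rewrite !natrD !natrM -mulr_natr; lra.
- rewrite (card_low false te).
  apply: (cubic 1 (-3) 2); first by rewrite te; apply: cubic_power_sums111.
  by move/toR: c1_2_3; rewrite !natrD !natrM -mulr_natr; lra.
Qed.
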